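(* Consider either the Taylor–Hood (TH) or the Raviart–Thomas (RT) isogeometric pressure discretization described in the context, with weighted pressure mass matrix $Q$ and parametric pressure mass matrix $P_Q$. Then $$\theta \le \lambda_{\min}\left(P_Q^{-1}Q\right), \qquad \lambda_{\max}\left(P_Q^{-1}Q\right)\le\Theta,$$ where $\theta$ and $\Theta$ are positive constants that do not depend on the mesh size $h$ or on the spline degree $p$.
   Context: For integers $p\ge 0$ and $0\le\alpha\le p-1$, let $\hat b^p_{\alpha,i}$, $i=1,\dots,m^p_\alpha$, be the univariate B-spline basis on $[0,1]$ of degree $p$ built on an open knot vector with uniformly spaced breakpoints of mesh size $h$ and $C^\alpha$ continuity at interior breakpoints. On $\hat\Omega=[0,1]^3$ let $\hat B_{\mathbf i}(\boldsymbol\eta)=\hat b^{p}_{\alpha_1,i_1}(\eta_1)\hat b^{p}_{\alpha_2,i_2}(\eta_2)\hat b^{p}_{\alpha_3,i_3}(\eta_3)$, $i_l=1,\dots,m^p_{\alpha_l}$. Let $\Omega=\mathbf G(\hat\Omega)\subset\mathbb R^3$ with $\mathbf G$ a spline parametrization (each component a tensor-product spline of degree $p$ in each direction) whose Jacobian $J_{\mathbf G}$ is everywhere invertible. The kinematic viscosity $\nu\in L^\infty(\Omega)$ satisfies $\nu>0$. Pressure basis functions: TH case $\rho_{\mathbf i}=\hat B_{\mathbf i}\circ\mathbf G^{-1}$; RT case $\rho_{\mathbf i}=\big((\det J_{\mathbf G})^{-1}\hat B_{\mathbf i}\big)\circ\mathbf G^{-1}$. Define $[Q]_{\mathbf i,\mathbf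 j}=\int_\Omega\nu^{-1}\rho_{\mathbf i}\rho_{\mathbf j}\,d\Omega$ and $[P_Q]_{\mathbf i,\mathbf j}=\int_{\hat\Omega}\hat B_{\mathbf i}\hat B_{\mathbf j}\,d\boldsymbol\eta$.
   Formalization: The viscosity ν is assumed essentially bounded below by a positive constant, not merely ν>0 (otherwise λ_max is unbounded as h→0, e.g. ν=√η₁ with G=id); ''J_G everywhere invertible'' is read as: the partial derivatives of G exist at every point of the closed cube. *)

(* Defs.v *)
From HB Require Import structures.
From mathcomp Require Import all_boot all_order all_algebra.
From mathcomp Require Import all_classical all_reals all_analysis.
Set Implicit Arguments. Unset Strict Implicit. Unset Printing Implicit Defensive.
Import Order.TTheory GRing.Theory Num.Theory.
Import numFieldNormedType.Exports.
Local Open Scope classical_set_scope.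
Local Open Scope ring_scope.

Section Splines.
Variable R : realType.

(* Knot vector t = [:: t_0; ...; t_K] (nondecreasing).  Degree-0 functions are
   indicator functions of [t_i, t_{i+1}); the last nonempty interval is taken
   closed at the right end (so that splines are defined on the closed [t_0,t_K]). *)
Fixpoint bspline (t : seq R) (p i : nat) (x : R) : R :=
  match p with
  | 0 =>
      let a := nth 0 t i in let b := nth 0 t i.+1 in
      if (a <= x) && (x < b) || [&& a < b, x == b & b == last 0 t]
      then 1 else 0
  | q.+1 =>
      (x - nth 0 t i) / (nth 0 t (i + q.+1) - nth 0 t i) * bspline t q i x
    + (nth 0 t (i + q.+2) - x) / (nth 0 t (i + q.+2) - nth 0 t i.+1)
        * bspline t q i.+1 x
  end.
(* In MathComp, y / 0 = 0, which implements the convention 0/0 = 0. *)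

(* Open knot vector on [0,1] with uniformly spaced breakpoints k/N (mesh size
   h = 1/N), degree p and C^alpha continuity at the interior breakpoints, i.e.
   every interior breakpoint has multiplicity p - alpha. *)
Definition uknots (p alpha N : nat) : seq R :=
  nseq p.+1 0 ++ flatten [seq nseq (p - alpha) (k%:R / N%:R) | k <- iota 1 N.-1]
  ++ nseq p.+1 1.

Definition mdim (p alpha N : nat) : nat := p.+1 + N.-1 * (p - alpha).

(* \hat b^p_{alpha,i}, 0-based index i < mdim p alpha N *)
Definition bsp (p alpha N i : nat) (x : R) : R := bspline (uknots p alpha N) p i x.

Definition pt := ((R * R) * R)%type.
Definition c1 (x : pt) : R := x.1.1.
Definition c2 (x : pt) : R := x.1.2.
Definition c3 (x : pt) : R := x.2.
Definition coord (k : 'I_3) (x : pt) : R :=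
  if val k == 0%N then c1 x else if val k == 1%N then c2 x else c3 x.
Definition upd (l : 'I_3) (x : pt) (s : R) : pt :=
  if val l == 0%N then ((s, c2 x), c3 x)
  else if val l == 1%N then ((c1 x, s), c3 x) else ((c1 x, c2 x), s).

Definition cube : set pt :=
  [set x | [/\ 0 <= c1 x <= 1, 0 <= c2 x <= 1 & 0 <= c3 x <= 1]].

Definition leb3 := ((@lebesgue_measure R \x @lebesgue_measure R) \x @lebesgue_measure R)%E.

(* Multi-indices (i1,i2,i3), i_l < m_l, are enumerated by a single index
   k < m1*m2*m3 via k = i1 + m1*(i2 + m2*i3). *)
Definition tp_basis (p a1 a2 a3 N : nat) (k : nat) (x : pt) : R :=
  let m1 := mdim p a1 N in let m2 := mdim p a2 N in
  bsp p a1 N (k %% m1) (c1 x) * bsp p a2 N ((k %/ m1) %% m2) (c2 x)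
  * bsp p a3 N (k %/ (m1 * m2)) (c3 x).

Definition tp_dim (p a1 a2 a3 N : nat) : nat := mdim p a1 N * mdim p a2 N * mdim p a3 N.

Definition spline_map (G : pt -> pt) : Prop :=
  exists (pG aG1 aG2 aG3 NG : nat) (cf : nat -> pt),
    [/\ (aG1 < pG)%N, (aG2 < pG)%N, (aG3 < pG)%N, (0 < NG)%N &
    forall x, cube x -> forall k : 'I_3,
      coord k (G x) = \sum_(j < tp_dim pG aG1 aG2 aG3 NG)
                         coord k (cf j) * tp_basis pG aG1 aG2 aG3 NG j x].

Definition partialG (G : pt -> pt) (k l : 'I_3) (x : pt) : R :=
  ((fun s : R => coord k (G (upd l x s)))^`() (coord l x))%classic.
Definition partial_exists (G : pt -> pt) (k l : 'I_3) (x : pt) : Prop :=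
  derivable (fun s : R => coord k (G (upd l x s))) (coord l x) 1.
Definition jac (G : pt -> pt) (x : pt) : 'M[R]_3 := \matrix_(k, l) partialG G k l x.
Definition detJ (G : pt -> pt) (x : pt) : R := \det (jac G x).

Definition Omega (G : pt -> pt) : set pt := G @` cube.
Definition Ginv (G : pt -> pt) (y : pt) : pt :=
  xget ((0, 0), 0) [set x | cube x /\ G x = y].

Inductive pdisc := TH | RT.

Definition rho (d : pdisc) (G : pt -> pt) (p a1 a2 a3 N k : nat) (y : pt) : R :=
  let x := Ginv G y in
  match d with
  | TH => tp_basis p a1 a2 a3 N k x
  | RT => (detJ G x)^-1 * tp_basis p a1 a2 a3 N k x
  end.

Definition Qmat (d : pdisc) (G : pt -> pt) (nu : pt -> R) (p a1 a2 a3 N : nat)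
  : 'M[R]_(tp_dim p a1 a2 a3 N) :=
  \matrix_(i, j) Rintegral leb3 (Omega G)
     (fun y => (nu y)^-1 * rho d G p a1 a2 a3 N i y * rho d G p a1 a2 a3 N j y).

Definition PQmat (p a1 a2 a3 N : nat) : 'M[R]_(tp_dim p a1 a2 a3 N) :=
  \matrix_(i, j) Rintegral leb3 cube
     (fun x => tp_basis p a1 a2 a3 N i x * tp_basis p a1 a2 a3 N j x).

End Splines.

(* Main.v *)
From Pilot Require Import Defs.
From HB Require Import structures.
From mathcomp Require Import all_boot all_order all_algebra.
From mathcomp Require Import all_classical all_reals all_analysis.
From mathcomp Require Import measurable_realfun.
From mathcomp Require Import ring lra zify.
Import Order.TTheory GRing.Theory Num.Theory.
Import numFieldNormedType.Exports.
Local Open Scope classical_set_scope.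
Local Open Scope ring_scope.
Set Implicit Arguments.
Unset Strict Implicit.
Unset Printing Implicit Defensive.

(* If v P^-1 Q = lambda v and w = v P^-1, then w Q w^T = lambda w P w^T.  With f
   the spline with coefficients w, w P w^T is the integral of f^2 over the cube
   and w Q w^T is the integral over Omega of W (f o G^-1)^2, where the weight W
   (1/nu, times (det J)^-2 for RT) lies between positive constants.  The
   comparison of the two integrals does not need the change of variables formula:
   G is bi-Lipschitz on the cube, and a Lipschitz map F satisfies
   int_(F K) psi <= C int_K (psi o F) with C depending on the Lipschitz constant
   only (cover the image of each cell of a fine grid by a cube); this is applied
   to G and to G^-1.
   G is bi-Lipschitz because a spline whose partial derivatives exist everywhere
   is C^1: near the diagonal the invertible Jacobian controls G x - G y, and away
   from it injectivity and compactness do.  P is invertible because the tensor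
   product B-splines are linearly independent. *)

(* [coord] of Defs is hidden by the one of mathcomp's vector.v. *)
Local Notation coord := Pilot.Defs.coord.

(** * Univariate B-splines *)

(** The constants can be uniform in [p] and [N] because the two integrals are compared for every
    continuous nonnegative function on the cube: the spline space enters only through squares of its
    elements. Linear independence serves to invert [P] and carries no quantitative content. The
    obstacle is regularity. Defined through half-open knot intervals, [bspline] may jump at 0 and 1
    as a function on the line; a C^0 basis function need not be differentiable at the breakpoints;
    and off the cube [G] is constrained only by the existence of its partial derivatives at boundary
    points. The given functions are therefore replaced by globally continuous ones ([bspc], sums of
    [tpd], [dJ]) that agree with them on the cube, so that compactness arguments need no boundary
    cases. *)

Section SplinePieces.
Variable R : realType.
Implicit Types (t : seq R) (q i j k r m : nat) (x xi : R).

(* The polynomial with which the B-spline [bspline t q i] coincides on the knot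
   span [t_j, t_(j+1)). *)
Fixpoint spoly t j q i : {poly R} :=
  match q with
  | 0 => ((i == j)%:R)%:P
  | q'.+1 =>
      (nth 0 t (i + q'.+1) - nth 0 t i)^-1 *: ('X - (nth 0 t i)%:P)
        * spoly t j q' i
    + (nth 0 t (i + q'.+2) - nth 0 t i.+1)^-1 *: ((nth 0 t (i + q'.+2))%:P - 'X)
        * spoly t j q' i.+1
  end.

Lemma spolyS t j q i : spoly t j q.+1 i =
      (nth 0 t (i + q.+1) - nth 0 t i)^-1 *: ('X - (nth 0 t i)%:P)
        * spoly t j q i
    + (nth 0 t (i + q.+2) - nth 0 t i.+1)^-1 *: ((nth 0 t (i + q.+2))%:P - 'X)
        * spoly t j q i.+1.
Proof. by []. Qed.

Lemma hornerE_spolyS t j q i x : (spoly t j q.+1 i).[x] =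
    (x - nth 0 t i) / (nth 0 t (i + q.+1) - nth 0 t i) * (spoly t j q i).[x]
  + (nth 0 t (i + q.+2) - x) / (nth 0 t (i + q.+2) - nth 0 t i.+1)
      * (spoly t j q i.+1).[x].
Proof. by rewrite spolyS !hornerE; congr (_ * _ + _ * _); rewrite mulrC. Qed.

Lemma bspline_spoly t j x q i :
  (forall i, bspline t 0 i x = (i == j)%:R) -> bspline t q i x = (spoly t j q i).[x].
Proof.
move=> H0; elim: q i => [|q IH] i; first by rewrite H0 hornerC.
by rewrite hornerE_spolyS -!IH.
Qed.

Lemma spoly_out t j q i : (j < i)%N || (i + q < j)%N -> spoly t j q i = 0.
Proof.
elim: q i => [|q IH] i h.
  rewrite /=; case: eqP => [ij|_]; last by rewrite polyC0.
  by move: h; rewrite ij addn0 ltnn.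
by rewrite spolyS !IH ?mulr0 ?addr0//; lia.
Qed.

(** At a knot of multiplicity at least the degree, B-splines interpolate. Since the knots involved
    coincide with [xi], the recursion keeps the value 1 at [i = j] with weight 1, and the weight
    with which it would spread to [i = j - 1] is 0. *)
Lemma spoly_left_knot t j q m i xi : (q <= m)%N -> nth 0 t j < xi ->
  (forall l, (j < l <= j + m)%N -> nth 0 t l = xi) ->
  (spoly t j q i).[xi] = (i == j)%:R.
Proof.
move=> qm tj tl; elim: q i qm => [|q IH] i qm; first by rewrite hornerC.
rewrite hornerE_spolyS !IH ?(ltnW qm)//.
have [->|ij] := eqVneq i j.
  rewrite (_ : j.+1 == j = false) ?mulr0 ?addr0 ?mulr1; last by lia.
  rewrite (tl (j + q.+1)%N); last by lia.
  by rewrite divff// gt_eqF// subr_gt0.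
rewrite mulr0 add0r; have [ij1|_] := eqVneq i.+1 j; last by rewrite mulr0.
rewrite (tl (i + q.+2)%N); last by lia.
by rewrite subrr !mul0r.
Qed.

Lemma spoly_right_knot t j q m i xi : (q <= m)%N -> xi < nth 0 t (j + m).+1 ->
  (forall l, (j < l <= j + m)%N -> nth 0 t l = xi) ->
  (spoly t (j + m) q i).[xi] = (i + q == j + m)%N%:R.
Proof.
move=> qm tj tl; elim: q i qm => [|q IH] i qm; first by rewrite hornerC addn0.
rewrite hornerE_spolyS !IH ?(ltnW qm)// addSnnS.
have [iq|_] := eqVneq (i + q.+1)%N (j + m)%N.
  rewrite (_ : (i + q == j + m)%N = false) ?mulr0 ?add0r ?mulr1; last by lia.
  rewrite [X in nth _ _ X](_ : _ = (j + m).+1); last by lia.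
  rewrite (tl i.+1); last by lia.
  by rewrite divff// gt_eqF// subr_gt0.
rewrite mulr0 addr0; have [iq|_] := eqVneq (i + q)%N (j + m)%N; last by rewrite mulr0.
by rewrite (tl i) ?subrr ?mul0r//; lia.
Qed.

(* At degree [m] both one-sided values are [i == j]; from there on the two
   recursions coincide. *)
Lemma spoly_continuous_knot t j q m i xi : (m <= q)%N ->
  nth 0 t j < xi < nth 0 t (j + m).+1 ->
  (forall l, (j < l <= j + m)%N -> nth 0 t l = xi) ->
  (spoly t j q i).[xi] = (spoly t (j + m) q i).[xi].
Proof.
move=> mq /andP[tj tm] tl; rewrite -(subnK mq); elim: (q - m)%N i => [|n IH] i.
  rewrite add0n (@spoly_left_knot _ _ _ m)// (@spoly_right_knot _ _ _ m)//.
  by rewrite eqn_add2r.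
by rewrite addSn !hornerE_spolyS !IH.
Qed.

(** Induction on the degree. In degree [q + 1] the first term gains a factor ['X - xi] over order
    [q - r]; the second comes from the case [r - 1], which already has order [q + 1 - r]. Both
    leading coefficients are nonnegative and one is positive: for [r = q + 1] the first term
    vanishes and the second takes over, for [r = 0] it is the reverse. *)
Lemma spoly_vanish t j q r xi : (r <= q)%N -> (r <= j)%N ->
  (forall l, (j - r <= l <= j)%N -> nth 0 t l = xi) ->
  (forall l, (j < l <= j + q)%N -> xi < nth 0 t l) ->
  exists2 u : {poly R}, spoly t j q (j - r) = ('X - xi%:P) ^+ (q - r) * u & 0 < u.[xi].
Proof.
elim: q r => [|q IH] r rq rj tl tg.
  move: rq; rewrite leqn0 => /eqP ->; exists 1; last by rewrite hornerC ltr01.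
  by rewrite subn0 /= eqxx expr0 mulr1.
have tg' l : (j < l <= j + q)%N -> xi < nth 0 t l by move=> h; apply: tg; lia.
pose a := (nth 0 t (j - r + q.+1)%N - xi)^-1.
pose b := (nth 0 t (j - r + q.+2)%N - nth 0 t (j - r).+1)^-1.
have tir : nth 0 t (j - r)%N = xi by apply: tl; lia.
have [u1 [e1 [u1ge u1gt]]] : exists u1 : {poly R},
    [/\ a *: ('X - xi%:P) * spoly t j q (j - r) = ('X - xi%:P) ^+ (q.+1 - r) * u1 &
       0 <= u1.[xi] /\ ((r <= q)%N -> 0 < u1.[xi])].
  have [rq'|rq'] := leqP r q.
    have [u eu u0] := IH r rq' rj tl tg'.
    have a0 : 0 < a by rewrite invr_gt0 subr_gt0; apply: tg; lia.
    have up : 0 < (a *: u).[xi] by rewrite hornerZ mulr_gt0.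
    exists (a *: u); split; last by rewrite ltW.
    by rewrite eu subSn// exprS -!scalerAl -scalerAr mulrA.
  exists 0; rewrite hornerC; split; last by split => //; rewrite leqNgt rq'.
  by rewrite spoly_out ?mulr0//; apply/orP; right; lia.
have [u2 [e2 [u2ge u2gt]]] : exists u2 : {poly R},
    [/\ b *: ((nth 0 t (j - r + q.+2)%N)%:P - 'X) * spoly t j q (j - r).+1
          = ('X - xi%:P) ^+ (q.+1 - r) * u2 &
       0 <= u2.[xi] /\ ((q < r)%N -> 0 < u2.[xi])].
  case: r rq rj tl @a @b tir u1 e1 u1ge u1gt => [|r] rq rj tl a b tir _ _ _ _.
    exists 0; rewrite hornerC mulr0; split => //.
    by rewrite spoly_out ?mulr0//; apply/orP; left; lia.
  have rq' : (r <= q)%N by lia.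
  have tl' l : (j - r <= l <= j)%N -> nth 0 t l = xi by move=> hl; apply: tl; lia.
  have [u eu u0] := IH r rq' (ltnW rj) tl' tg'.
  have -> : (j - r.+1).+1 = (j - r)%N by lia.
  have tq : xi < nth 0 t (j - r.+1 + q.+2)%N by apply: tg; lia.
  have b0 : 0 < b.
    by rewrite invr_gt0 subr_gt0 (tl (j - r.+1).+1)//; lia.
  exists (b *: ((nth 0 t (j - r.+1 + q.+2)%N)%:P - 'X) * u); split.
    by rewrite eu mulrCA.
  have up : 0 < (b *: ((nth 0 t (j - r.+1 + q.+2)%N)%:P - 'X) * u).[xi].
    by rewrite !hornerE mulr_gt0// mulr_gt0// subr_gt0.
  by rewrite ltW.
exists (u1 + u2); first by rewrite spolyS tir e1 e2 mulrDr.
rewrite hornerD; have [rq'|rq'] := leqP r q; first by rewrite ltr_pwDl ?u1gt.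
by rewrite ltr_wpDl ?u2gt.
Qed.

End SplinePieces.

(** * B-splines on the uniform open knot vector: closed spans and linear independence *)

Section UniformKnots.
Variable R : realType.
Implicit Types (i j k l r : nat) (x y : R).

(* The [i]-th knot is [kidx p m N i / N] when interior knots have multiplicity [m]. *)
Definition kidx (p m N i : nat) : nat := minn N ((i - p + m.-1) %/ m).

(** [kidx] is a ceiling capped at [N]; this adjunction turns comparisons of knots into linear
    inequalities between indices. *)
Lemma kidx_leq p m N i k : (0 < m)%N -> (k < N)%N ->
  (kidx p m N i <= k)%N = (i <= p + k * m)%N.
Proof.
move=> m0 kN; rewrite /kidx geq_min [(N <= k)%N]leqNgt kN /= -ltnS ltn_divLR//.
by rewrite mulSn; apply/idP/idP; lia.
Qed.

Lemma kidx_leN p m N i : (kidx p m N i <= N)%N.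
Proof. by rewrite geq_minl. Qed.

Lemma nth_flatten_nseq (T : Type) (x0 : T) (f : nat -> T) (m s K i : nat) :
  (i < K * m)%N ->
  nth x0 (flatten [seq nseq m (f k) | k <- iota s K]) i = f (s + i %/ m)%N.
Proof.
elim: K s i => [|K IH] s i; first by rewrite mul0n.
move=> iK; have m0 : (0 < m)%N by rewrite lt0n; apply: contraTneq iK => ->; rewrite muln0.
rewrite /= nth_cat size_nseq; case: ltnP => im.
  by rewrite nth_nseq im divn_small// addn0.
rewrite IH; last by move: iK; rewrite mulSn; lia.
by rewrite -[in RHS](subnK im) divnDr ?dvdnn// divnn m0; congr f; lia.
Qed.

Lemma size_uknots p a N :
  size (uknots R p a N) = (p.+1 + (N.-1 * (p - a) + p.+1))%N.
Proof.
rewrite /uknots !size_cat !size_nseq size_flatten /shape -map_comp.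
rewrite (@eq_map _ _ _ (fun=> (p - a)%N)); last by move=> k /=; rewrite size_nseq.
by rewrite sumnE big_map big_const_seq count_predT size_iota iter_addn_0 mulnC.
Qed.

Lemma bspline0E (t : seq R) i x : bspline t 0 i x =
  if (nth 0 t i <= x) && (x < nth 0 t i.+1)
     || [&& nth 0 t i < nth 0 t i.+1, x == nth 0 t i.+1 & nth 0 t i.+1 == last 0 t]
  then 1 else 0.
Proof. by []. Qed.

Lemma last_uknots p a N : last 0 (uknots R p a N) = 1.
Proof. by rewrite /uknots !last_cat /=; elim: p => //= p ->. Qed.

Variables (p a N : nat).
Hypotheses (ap : (a < p)%N) (N0 : (0 < N)%N).
Let m := (p - a)%N.
Let uk := uknots R p a N.
(** The index of the last copy of the knot [k / N], hence of the only nonempty knot interval that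
    starts there. *)
Let span k := (p + k * m)%N.

Let m0 : (0 < m)%N. Proof. by rewrite /m subn_gt0. Qed.
Let NR0 : 0 < N%:R :> R. Proof. by rewrite ltr0n. Qed.

Lemma nth_uknots i : (i < p.+1 + (N.-1 * m + p.+1))%N ->
  nth 0 uk i = (kidx p m N i)%:R / N%:R.
Proof.
move=> iN; rewrite /uk /uknots nth_cat size_nseq nth_nseq.
have [ip|ip] := ltnP i p.+1.
  suff -> : kidx p m N i = 0%N by rewrite mul0r.
  by apply/eqP; rewrite -leqn0 kidx_leq// addn0 -ltnS.
have szf : size (flatten [seq nseq (p - a) (k%:R / N%:R : R) | k <- iota 1 N.-1])
    = (N.-1 * m)%N.
  by have := size_uknots p a N; rewrite /uknots !size_cat !size_nseq => /addnI /addIn.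
rewrite nth_cat szf; case: ltnP => iNm.
  rewrite nth_flatten_nseq//; congr (_%:R / _); rewrite /kidx.
  have -> : (i - p + m.-1 = (i - p.+1) + m)%N by lia.
  rewrite divnDr ?dvdnn// divnn m0 addn1 add1n -/m.
  apply/esym/minn_idPr; rewrite -[X in (_ <= X)%N](prednK N0) ltnS -ltnS.
  by rewrite ltn_divLR//; move: iNm; rewrite mulSn; lia.
rewrite nth_nseq (_ : (i - p.+1 - N.-1 * m < p.+1)%N); last by lia.
suff -> : kidx p m N i = N by rewrite divff// gt_eqF.
apply/eqP; rewrite eqn_leq kidx_leN /= -[X in (X <= _)%N](prednK N0) ltnNge.
by rewrite kidx_leq ?prednK//; lia.
Qed.

Lemma nth_uknots_out i : (p.+1 + (N.-1 * m + p.+1) <= i)%N -> nth 0 uk i = 0.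
Proof. by move=> h; rewrite nth_default// size_uknots. Qed.

Let span_le k : (k < N)%N -> (span k <= span N.-1)%N.
Proof. by move=> kN; rewrite leq_add2l leq_pmul2r// -ltnS prednK. Qed.

Let ler_frac k l : (k%:R / N%:R <= l%:R / N%:R :> R) = (k <= l)%N.
Proof. by rewrite ler_pM2r ?invr_gt0// ler_nat. Qed.
Let ltr_frac k l : (k%:R / N%:R < l%:R / N%:R :> R) = (k < l)%N.
Proof. by rewrite ltr_pM2r ?invr_gt0// ltr_nat. Qed.

(** Every other index gives an empty knot interval or one lying to one side of [x]. The alternative
    [x == 1] reflects the convention that closes the last nonempty interval on the right. *)
Lemma bspline0_uknots k x i : (k < N)%N -> k%:R / N%:R <= x ->
  (x < k.+1%:R / N%:R) || (x == 1) && (k.+1 == N) ->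
  bspline uk 0 i x = (i == span k)%:R.
Proof.
have luk : last 0 uk = 1 := last_uknots p a N.
move=> kN kx xk; rewrite bspline0E luk.
have x1 : x <= 1.
  case/orP: xk => [xk|/andP[/eqP-> _]//]; apply: (le_trans (ltW xk)).
  by rewrite ler_pdivrMr// mul1r ler_nat.
have x0 : 0 <= x by apply: le_trans kx; rewrite divr_ge0.
have spN := span_le kN.
(* Past the end of the knot vector [nth] returns the default 0, so the interval cannot contain
   [x >= 0]. Such indices matter because [bspline_spoly] asks for the degree-0 values at all [i]. *)
have [iN|iN] := ltnP i.+1 (p.+1 + (N.-1 * m + p.+1))%N; last first.
  rewrite (nth_uknots_out iN) (ltNge x) x0 andbF.
  have -> : (nth 0 uk i < 0) = false.
    have [iN'|iN'] := ltnP i (p.+1 + (N.-1 * m + p.+1))%N.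
      by rewrite nth_uknots// ltNge divr_ge0.
    by rewrite nth_uknots_out// ltxx.
  have -> // : (i == span k) = false.
  by apply/eqP => ik; move: iN spN; rewrite ik /span; lia.
rewrite !nth_uknots//; last exact: ltnW.
have [ik|ik|->] := ltngtP i (span k).
- have h : (kidx p m N i.+1 <= k)%N by rewrite kidx_leq.
  have h1 : (kidx p m N i.+1)%:R / N%:R <= x.
    by apply: le_trans kx; rewrite ler_frac.
  rewrite (ltNge x) h1 andbF /=; case: ifP => // /and3P[_ /eqP xe /eqP x1'].
  have := h; rewrite -ler_frac x1' ler_pdivlMr// mul1r ler_nat => Nk.
  by move: kN; rewrite ltnNge Nk.
- have h : (k < kidx p m N i)%N by rewrite ltnNge kidx_leq// -ltnNge.
  case/orP: xk => [xk|/andP[/eqP-> /eqP kNe]].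
    have h1 : x < (kidx p m N i)%:R / N%:R.
      by apply: (lt_le_trans xk); rewrite ler_frac.
    rewrite (leNgt _ x) h1 /=; case: ifP => // /and3P[lt /eqP xe _].
    by move: (lt_trans h1 lt); rewrite xe ltxx.
  have -> : kidx p m N i = N.
    by apply/eqP; rewrite eqn_leq kidx_leN -[X in (X <= _)%N]kNe h.
  rewrite divff ?(gt_eqF NR0)//.
  have le1 : (kidx p m N i.+1)%:R / N%:R <= 1 :> R.
    by rewrite ler_pdivrMr// mul1r ler_nat kidx_leN.
  by rewrite [1 < _]ltNge le1 andbF.
- have -> : kidx p m N (span k) = k.
    apply/eqP; rewrite eqn_leq kidx_leq// leqnn /=.
    case: k kN {kx xk spN} => // k kN.
    by rewrite ltnNge kidx_leq ?(ltnW kN)// -ltnNge /span mulSn; lia.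
  have -> : kidx p m N (span k).+1 = k.+1.
    apply/eqP; rewrite eqn_leq andbC ltnNge kidx_leq// -ltnNge ltnSn /=.
    have [kN'|] := ltnP k.+1 N; last by apply: leq_trans; rewrite kidx_leN.
    by rewrite kidx_leq// /span mulSn; lia.
  rewrite kx /=; case/orP: xk => [-> //|/andP[/eqP-> /eqP <-]].
  by rewrite divff ?pnatr_eq0// eqxx /= ltr_pdivrMr// ?mul1r ?ltr_nat ?ltnSn ?orbT.
Qed.

(** The closed right end is the point of the lemma: there [bsp] follows the piece of the next span,
    and the two pieces agree because the multiplicity [p - a] of the breakpoint does not exceed the
    degree. *)
Lemma bsp_span k x i : (k < N)%N -> k%:R / N%:R <= x <= k.+1%:R / N%:R ->
  bsp p a N i x = (spoly uk (span k) p i).[x].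
Proof.
move=> kN /andP[kx xk]; rewrite /bsp.
case: (boolP ((x < k.+1%:R / N%:R) || (x == 1) && (k.+1 == N))) => [h|].
  by apply: bspline_spoly => l; exact: bspline0_uknots.
rewrite negb_or -leNgt => /andP[kx' h].
have {xk kx' kx} xe : x = k.+1%:R / N%:R by apply/eqP; rewrite eq_le xk kx'.
have kN' : (k.+1 < N)%N.
  rewrite ltn_neqAle kN andbT; apply: contraNneq h => kNe.
  by rewrite xe kNe divff ?eqxx// gt_eqF.
have -> : bspline (uknots R p a N) p i x = (spoly uk (span k.+1) p i).[x].
  apply: bspline_spoly => l; apply: bspline0_uknots => //; rewrite xe//.
  by rewrite ltr_frac ltnSn.
have spN := span_le kN'.
have sp1 : (span k + m = span k.+1)%N by rewrite /span mulSn; lia.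
rewrite -sp1; apply/esym/spoly_continuous_knot.
- by rewrite /m leq_subr.
- rewrite sp1 !nth_uknots; [|move: spN; rewrite /span; lia..].
  rewrite xe !ltr_frac; apply/andP; split.
    by rewrite ltnS kidx_leq// leqnn.
  by rewrite ltnNge kidx_leq// -ltnNge ltnSn.
move=> l; rewrite sp1 => /andP[l1 l2].
rewrite nth_uknots; last by move: spN l2; rewrite /span; lia.
by rewrite xe; congr (_%:R / _); apply/eqP; rewrite eqn_leq kidx_leq// l2 ltnNge
   kidx_leq// -ltnNge.
Qed.

(** Here [k / N] is the first knot of the basis function [i], and the functions [l] up to [span k]
    start at the same breakpoint with fewer copies of it. Their orders [p - (span k - l)] there
    increase strictly with [l]; the final bound ensures that the subtraction is not truncated at
    [l = i]. *)
Lemma spoly_uknots_vanish i : (i < mdim p a N)%N ->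
  exists k, [/\ (k < N)%N, (i <= span k)%N &
    forall l, (i <= l <= span k)%N ->
    exists2 u : {poly R}, spoly uk (span k) p l
        = ('X - (k%:R / N%:R)%:P) ^+ (p - (span k - l)) * u & 0 < u.[k%:R / N%:R]]
   /\ (span k - i <= p)%N.
Proof.
rewrite /mdim -/m => iN.
have kN : (kidx p m N i < N)%N.
  by rewrite -[X in (_ < X)%N](prednK N0) ltnS kidx_leq ?prednK//; lia.
have ik : (i <= span (kidx p m N i))%N by rewrite /span -(kidx_leq p i m0 kN).
have kN' : (kidx p m N i <= N.-1)%N by rewrite -ltnS prednK.
have sN := span_le kN.
have ki l : (i <= l)%N -> (kidx p m N i <= kidx p m N l)%N.
  move=> il; have : (i - p + m.-1 <= l - p + m.-1)%N by lia.
  by move=> /(leq_div2r m); rewrite /kidx; lia.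
have rp : (span (kidx p m N i) - i <= p)%N.
  case E : (kidx p m N i) => [|k]; first by rewrite /span; lia.
  have kN2 : (k < N)%N by move: kN; rewrite E => /ltnW.
  have : (kidx p m N i <= k)%N = false by rewrite E ltnn.
  rewrite kidx_leq// => /negbT.
  by rewrite /span mulSn /m; lia.
exists (kidx p m N i); split=> //; split=> // l /andP[il lk].
rewrite -[in spoly _ _ _ _](subKn lk).
apply: spoly_vanish; [lia|lia|move=> l' hl'|move=> l' hl'].
  rewrite nth_uknots; last by move: sN hl'; rewrite /span; lia.
  congr (_%:R / _); apply/eqP; rewrite eqn_leq ki ?andbT; last by lia.
  by rewrite kidx_leq//; move: hl'; rewrite /span; lia.
rewrite nth_uknots; last by move: sN hl'; rewrite /span; lia.
by rewrite ltr_frac ltnNge kidx_leq// -ltnNge; move: hl'; rewrite /span; lia.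
Qed.

Lemma poly_eq0_itv (P : {poly R}) x y : x < y ->
  (forall z, x <= z <= y -> P.[z] = 0) -> P = 0.
Proof.
move=> xy P0; pose f (n : nat) := x + (y - x) / n.+1%:R.
have yx : 0 < y - x by rewrite subr_gt0.
apply: (@roots_geq_poly_eq0 _ _ [seq f n | n <- iota 0 (size P)]).
- apply/allP => _ /mapP[n _ ->]; apply/rootP/P0; apply/andP; split.
    by rewrite lerDl divr_ge0// ltW.
  by rewrite -lerBrDl ler_pdivrMr// ler_peMr ?(ltW yx) ?ler1n.
- rewrite map_inj_uniq ?iota_uniq// => n n' /addrI /(mulfI (lt0r_neq0 yx)) /invr_inj.
  by move=> /eqP; rewrite eqr_nat => /eqP[].
- by rewrite size_map size_iota.
Qed.

(* On the span to the right of its first knot, [bsp i] vanishes there to a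
   strictly lower order than every later basis function, so the coefficients
   can be peeled off from left to right. *)
Lemma bsp_free (c : nat -> R) :
  (forall x, 0 <= x <= 1 -> \sum_(i < mdim p a N) c i * bsp p a N i x = 0) ->
  forall i, (i < mdim p a N)%N -> c i = 0.
Proof.
move=> H; elim/ltn_ind => i IH iN.
have [k [[kN ik van] rp]] := spoly_uknots_vanish iN.
set xi := k%:R / N%:R in van.
have S0 : \sum_(l < mdim p a N) c l *: spoly uk (span k) p l = 0.
  apply: (@poly_eq0_itv _ xi (k.+1%:R / N%:R)); first by rewrite ltr_frac.
  move=> z hz; rewrite horner_sum -[RHS](H z).
    by apply: eq_bigr => l _; rewrite hornerZ (bsp_span _ kN).
  case/andP: hz => z1 z2; rewrite (le_trans _ z1) ?divr_ge0//=.
  by rewrite (le_trans z2)// ler_pdivrMr// mul1r ler_nat.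
have /van[u eu u0] : (i <= i <= span k)%N by rewrite leqnn.
have dv : ('X - xi%:P) ^+ (p - (span k - i)).+1 %| c i *: spoly uk (span k) p i.
  move: S0; rewrite (bigD1 (Ordinal iN))//= => /eqP; rewrite addr_eq0 => /eqP ->.
  rewrite dvdpNr; apply: (big_ind (fun P => _ %| P)) => [|P Q|l li].
  - exact: dvdp0.
  - exact: dvdp_add.
  have [lk|lk] := leqP l (span k); last first.
    by rewrite spoly_out ?lk// scaler0 dvdp0.
  have [il|il] := leqP i l; last by rewrite IH// scale0r dvdp0.
  have il' : (i < l)%N.
    by rewrite ltn_neqAle il andbT eq_sym; apply: contraNneq li => e; apply/eqP/val_inj.
  have [|v -> _] := van l; first by rewrite il lk.
  by rewrite scalerAr dvdp_mulr// dvdp_exp2l//; lia.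
move: dv; rewrite eu scalerAr exprSr dvdp_mul2l; last first.
  by rewrite expf_neq0// polyXsubC_eq0.
by rewrite dvdp_XsubCl rootE hornerZ mulf_eq0 (gt_eqF u0) orbF => /eqP.
Qed.

Lemma itv01_span x : 0 <= x <= 1 ->
  exists2 k, (k < N)%N & k%:R / N%:R <= x <= k.+1%:R / N%:R.
Proof.
case/andP=> x0 x1.
pose P k := (k < N)%N && (k%:R / N%:R <= x).
have [|k Pk|k /andP[kN kx] kmax] := @ex_maxnP P N.
- by exists 0%N; rewrite /P N0 mul0r.
- by case/andP: Pk => /ltnW.
exists k => //; rewrite kx /=; have [kN'|kN'] := ltnP k.+1 N; last first.
  by rewrite (le_trans x1)// ler_pdivlMr// mul1r ler_nat.
rewrite leNgt; apply/negP => xk.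
by have := kmax k.+1; rewrite /P kN' ltW//= ltnn => /(_ isT).
Qed.

End UniformKnots.

Lemma continuous_sumr (R : realType) (T : topologicalType) (I : Type) (r : seq I)
    (f : I -> T -> R) : (forall i, continuous (f i)) ->
  continuous (fun x => \sum_(i <- r) f i x).
Proof.
move=> cf; elim: r => [|i r IH].
  by under eq_fun do rewrite big_nil; move=> x; exact: cvg_cst.
under eq_fun do rewrite big_cons.
by move=> x; apply: cvgD; [exact: cf|exact: IH].
Qed.

(** * Continuous extension of piecewise polynomials to the line *)

Section Glue.
Variable R : realType.
Implicit Types (P : nat -> {poly R}) (x : R).

(* Extends the continuous piecewise polynomial with pieces [P k] on
   [k/N, (k+1)/N] to a continuous function on the whole line; the subtracted
   jumps vanish when consecutive pieces match. *)
Definition glue P N x : R := (P 0).[x] +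
  \sum_(1 <= k < N) ((P k - P k.-1).[Num.max x (k%:R / N%:R)]
                     - (P k - P k.-1).[k%:R / N%:R]).

(** Jumps at breakpoints beyond [x] contribute 0, as the maximum is then the breakpoint itself;
    those before [x] telescope to [P k - P 0]. *)
Lemma glue_span P N k x :
  (forall k, (0 < k < N)%N -> (P k.-1).[k%:R / N%:R] = (P k).[k%:R / N%:R]) ->
  (k < N)%N -> k%:R / N%:R <= x <= k.+1%:R / N%:R -> glue P N x = (P k).[x].
Proof.
move=> Pk kN /andP[kx xk]; have N0 : (0 < N)%N by apply: leq_ltn_trans kN.
have NR0 : 0 < N%:R :> R by rewrite ltr0n.
have lef i j : (i%:R / N%:R <= j%:R / N%:R :> R) = (i <= j)%N.
  by rewrite ler_pM2r ?invr_gt0// ler_nat.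
rewrite /glue (big_cat_nat (n := k.+1))//=.
rewrite [X in _ + (_ + X)]big_nat_cond [X in _ + (_ + X)]big1 ?addr0; last first.
  move=> j /andP[/andP[kj jN] _]; rewrite max_r ?subrr//.
  by rewrite (le_trans xk)// lef.
rewrite (_ : \sum_(1 <= i < k.+1) _ = \sum_(1 <= i < k.+1) ((P i).[x] - (P i.-1).[x])).
  rewrite big_add1 /= (telescope_sumr (fun i => (P i).[x]))// addrC subrK//.
rewrite big_nat_cond [RHS]big_nat_cond; apply: eq_bigr => j /andP[/andP[j0 jk] _].
rewrite max_l; last by rewrite (le_trans _ kx)// lef.
by rewrite !hornerD !hornerN Pk ?subrr ?subr0// j0 (leq_trans jk).
Qed.

Lemma glue_continuous P N : continuous (glue P N).
Proof.
move=> x; apply: cvgD; first exact: continuous_horner.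
apply: continuous_sumr => k {}x; apply: cvgB; last exact: cvg_cst.
apply: (@continuous_comp _ _ _ (fun x : R => Num.max x (k%:R / N%:R)) (horner (P k - P k.-1))).
  apply: continuous_max => //; exact: cvg_cst.
exact: continuous_horner.
Qed.

Lemma glue_sum (I : finType) (c : I -> R) (P : I -> nat -> {poly R}) N x :
  \sum_i c i * glue (P i) N x = glue (fun k => \sum_i c i *: P i k) N x.
Proof.
rewrite /glue; under eq_bigr do rewrite mulrDr.
rewrite big_split /= horner_sum; congr (_ + _).
  by apply: eq_bigr => i _; rewrite hornerZ.
under eq_bigr do rewrite mulr_sumr.
rewrite exchange_big; apply: eq_bigr => k _ /=.
rewrite !hornerD !hornerN !horner_sum -!sumrB; apply: eq_bigr => i _.
by rewrite !hornerD !hornerN !hornerZ; ring.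
Qed.

(** As [s] may be an end point, [h] is known on one side only. The two-sided limit of the quotient
    of [h - q] exists by assumption, so it can be read along increments that stay in [[a, b]], where
    the quotient is 0. *)
Lemma derive1_piece (h : R -> R) (q : {poly R}) a b s : a < b -> a <= s <= b ->
  (forall x, a <= x <= b -> h x = q.[x]) -> derivable h s 1 ->
  (h^`())%classic s = q^`().[s].
Proof.
move=> ab /andP[sa sb] hq dh; rewrite derive1E.
have dq : is_derive s 1 (horner q) q^`().[s] by exact: is_derive_poly.
have dz : is_derive s 1 (h \- horner q) ('D_1 h s - q^`().[s]).
  by apply: is_deriveB; apply: DeriveDef.
apply/eqP; rewrite -subr_eq0; move: dz => [/cvg_ex[/= L HL] eqL].
have LE : 'D_1 (h \- horner q) s = L by apply: cvg_lim.
rewrite -eqL LE -normr_le0; apply/ler_addgt0Pr => e e0; rewrite add0r.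
have /cvgrPdist_le /(_ e e0) := HL; rewrite near_withinE /=.
case/nbhs_ballP => d /= d0 Hd.
suff [t [t0 td ts]] : exists t : R, [/\ t != 0, `|t| < d & a <= s + t <= b].
  have /Hd : ball 0 d t by rewrite /ball /= sub0r normrN.
  move=> /(_ t0) /=; rewrite /= (addrC _ s) [t%:A]mulr1 !hq ?sa ?sb// !subrr.
  by rewrite scaler0 subr0.
have [sb'|sb'] := ltP s b.
  exists (Num.min (d / 2) (b - s)); have m0 : 0 < Num.min (d / 2) (b - s).
    by rewrite lt_min divr_gt0//= subr_gt0.
  split; first by rewrite gt_eqF.
    by rewrite gtr0_norm// gt_min ltr_pdivrMr// ltr_pMr// ltr1n.
  apply/andP; split; first by rewrite (le_trans sa)// lerDl ltW.
  by rewrite -lerBrDl ge_min lexx orbT.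
have {sb sb'} -> : s = b by apply/eqP; rewrite eq_le sb.
exists (- Num.min (d / 2) (b - a)); have m0 : 0 < Num.min (d / 2) (b - a).
  by rewrite lt_min divr_gt0//= subr_gt0.
split; first by rewrite oppr_eq0 gt_eqF.
  by rewrite normrN gtr0_norm// gt_min ltr_pdivrMr// ltr_pMr// ltr1n.
apply/andP; split; last by rewrite gerDl oppr_le0 ltW.
by rewrite lerBrDr -lerBrDl ge_min lexx orbT.
Qed.

(** Differentiability of [h] at a breakpoint forces the two adjacent derived pieces to agree there,
    both being the derivative of [h]. This is the matching condition under which [glue] can be
    evaluated. *)
Lemma derive1_glue (h : R -> R) P N : (0 < N)%N ->
  (forall k, (0 < k < N)%N -> (P k.-1).[k%:R / N%:R] = (P k).[k%:R / N%:R]) ->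
  (forall x, 0 <= x <= 1 -> h x = glue P N x) ->
  (forall x, 0 <= x <= 1 -> derivable h x 1) ->
  forall x, 0 <= x <= 1 -> (h^`())%classic x = glue (fun k => (P k)^`()) N x.
Proof.
move=> N0 HP hP dh; have NR0 : 0 < N%:R :> R by rewrite ltr0n.
have ltf i : i%:R / N%:R < i.+1%:R / N%:R :> R.
  by rewrite ltr_pM2r ?invr_gt0// ltr_nat.
have in01 k x : (k < N)%N -> k%:R / N%:R <= x <= k.+1%:R / N%:R -> 0 <= x <= 1.
  move=> kN /andP[kx xk]; rewrite (le_trans _ kx) ?divr_ge0//=.
  by rewrite (le_trans xk)// ler_pdivrMr// mul1r ler_nat.
have dP k x : (k < N)%N -> k%:R / N%:R <= x <= k.+1%:R / N%:R ->
    (h^`())%classic x = (P k)^`().[x].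
  move=> kN kx; apply: (derive1_piece (ltf k) kx); last exact/dh/(in01 k).
  by move=> y ky; rewrite hP ?(in01 k)// (glue_span HP kN ky).
move=> x /(itv01_span N0)[k kN kx].
rewrite (dP _ _ kN kx) (glue_span _ kN kx)// => {x k kN kx} k /andP[k0 kN].
rewrite -dP ?(leq_ltn_trans (leq_pred _) kN)//; last first.
  by rewrite prednK// lexx andbT; have := ltf k.-1; rewrite prednK// => /ltW.
by rewrite -dP// lexx ltW.
Qed.

End Glue.

Section UnivariateExtension.
Variable R : realType.
Variables (p a N : nat).
Hypotheses (ap : (a < p)%N) (N0 : (0 < N)%N).

Definition bpiece i k : {poly R} := spoly (uknots R p a N) (p + k * (p - a)) p i.
Definition bspc i : R -> R := glue (bpiece i) N.
(** For [a = 0] the derived pieces of a single basis function need not match at the breakpoints, and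
    [dbspc] is then in general not its derivative. What counts is that [glue] is continuous and
    linear in the pieces: in a differentiable combination the mismatches cancel. *)
Definition dbspc i : R -> R := glue (fun k => (bpiece i k)^`()) N.

Lemma bpiece_match i k : (0 < k < N)%N ->
  (bpiece i k.-1).[k%:R / N%:R] = (bpiece i k).[k%:R / N%:R].
Proof.
move=> /andP[k0 kN]; have NR0 : 0 < N%:R :> R by rewrite ltr0n.
have lef i' j : (i'%:R / N%:R <= j%:R / N%:R :> R) = (i' <= j)%N.
  by rewrite ler_pM2r ?invr_gt0// ler_nat.
rewrite /bpiece -bsp_span ?(leq_ltn_trans (leq_pred _) kN)//; last first.
  by rewrite !lef prednK// leqnn leq_pred.
by rewrite -bsp_span// !lef leqnn leqnSn.
Qed.

Lemma bspcE i x : 0 <= x <= 1 -> bsp p a N i x = bspc i x.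
Proof.
move=> /(itv01_span N0)[k kN kx].
by rewrite (bsp_span ap N0 _ kN kx) /bspc (glue_span _ kN kx)//; exact: bpiece_match.
Qed.

Lemma bspc_continuous i : continuous (bspc i).
Proof. exact: glue_continuous. Qed.

Lemma dbspc_continuous i : continuous (dbspc i).
Proof. exact: glue_continuous. Qed.

Lemma derive1_bsp_sum (I : finType) (c : I -> R) (f : I -> nat) (h : R -> R) :
  (forall x, 0 <= x <= 1 -> h x = \sum_i c i * bsp p a N (f i) x) ->
  (forall x, 0 <= x <= 1 -> derivable h x 1) ->
  forall x, 0 <= x <= 1 -> (h^`())%classic x = \sum_i c i * dbspc (f i) x.
Proof.
move=> hE dh x x01; rewrite glue_sum.
have -> : (fun k => \sum_i c i *: (bpiece (f i) k)^`())
    = (fun k => (\sum_i c i *: bpiece (f i) k)^`()).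
  by apply/funext => k; rewrite linear_sum /=; apply: eq_bigr => i _; rewrite derivZ.
apply: (derive1_glue N0 _ _ dh x01) => [k kN|y y01].
  by rewrite !horner_sum; apply: eq_bigr => i _; rewrite !hornerZ bpiece_match.
by rewrite hE// -glue_sum; apply: eq_bigr => i _; rewrite bspcE.
Qed.

(** The index map [f] may repeat values, so independence is applied to the coefficients collected
    along its fibres. With [f] one digit of a flattened multi-index, this peels off one tensor
    direction. *)
Lemma bsp_free_partition (I : finType) (A : pred I) (f : I -> nat) (g : I -> R) :
  (forall i, A i -> (f i < mdim p a N)%N) ->
  (forall x, 0 <= x <= 1 -> \sum_(i | A i) g i * bsp p a N (f i) x = 0) ->
  forall j, \sum_(i | A i && (f i == j)) g i = 0.
Proof.
move=> fN H j; have [jN|jN] := ltnP j (mdim p a N); last first.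
  rewrite big_pred0// => i; apply/negP => /andP[/fN Ai /eqP fj].
  by move: Ai; rewrite fj ltnNge jN.
apply: (bsp_free ap N0 (c := fun j => \sum_(i | A i && (f i == j)) g i)) => // x x01.
rewrite -[RHS](H x x01); under eq_bigr do rewrite mulr_suml.
rewrite (exchange_big_dep A)/=; last by move=> l i _ /andP[].
apply: eq_bigr => i Ai; rewrite (big_pred1 (Ordinal (fN i Ai)))// => l.
by rewrite Ai /= eq_sym -val_eqE.
Qed.

End UnivariateExtension.

(** * Tensor product splines *)

Section Coordinates.
Variable R : realType.

Lemma c1_continuous : continuous (@c1 R).
Proof. by move=> x; apply: (@continuous_comp _ _ _ fst fst); exact: cvg_fst. Qed.

Lemma c2_continuous : continuous (@c2 R).
Proof.
by move=> x; apply: (@continuous_comp _ _ _ fst snd); [exact: cvg_fst|exact: cvg_snd].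
Qed.

Lemma c3_continuous : continuous (@c3 R).
Proof. by move=> x; exact: cvg_snd. Qed.

Lemma cube_coord (x : pt R) : cube x <-> forall l, 0 <= coord l x <= 1.
Proof.
split=> [[x1 x2 x3] [[|[|[|//]]] i]//|h].
by split; [exact: (h ord0)|exact: (h (@Ordinal 3 1 isT)) |exact: (h ord_max)].
Qed.

Lemma coord_upd k l (x : pt R) s : coord k (upd l x s) = if k == l then s else coord k x.
Proof.
by case: k => [[|[|[|//]]] i]; case: l => [[|[|[|//]]] j].
Qed.

Lemma upd_upd l (x : pt R) s s' : upd l (upd l x s) s' = upd l x s'.
Proof. by case: l => [[|[|[|//]]] j]. Qed.

Lemma upd_id l (x : pt R) : upd l x (coord l x) = x.
Proof. by case: x => [[? ?] ?]; case: l => [[|[|[|//]]] j]. Qed.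

Lemma coord_inj (x y : pt R) : (forall k, coord k x = coord k y) -> x = y.
Proof.
move=> h; have := h ord0; have := h ord_max; have := h (@Ordinal 3 1 isT).
case: x y {h} => [[x1 x2] x3] [[y1 y2] y3].
by rewrite /coord /= /c1 /c2 /c3 /= => -> -> ->.
Qed.

Lemma cube_upd l (x : pt R) s : cube x -> 0 <= s <= 1 -> cube (upd l x s).
Proof.
move=> /cube_coord cx s01; apply/cube_coord => k; rewrite coord_upd.
by case: ifP.
Qed.

End Coordinates.

Section TensorBasis.
Variable R : realType.
Variables (p a1 a2 a3 N : nat).
Hypotheses (ap1 : (a1 < p)%N) (ap2 : (a2 < p)%N) (ap3 : (a3 < p)%N) (N0 : (0 < N)%N).
Let m1 := mdim p a1 N.
Let m2 := mdim p a2 N.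

(* [tpd l k] is the continuous version of the [l]-th partial derivative of the
   [k]-th basis function for [l < 3], and of that function itself for [l = 3]. *)
Definition tpd (l k : nat) (x : pt R) : R :=
  (if l == 0 then dbspc p a1 N else bspc p a1 N) (k %% m1)%N (c1 x)
  * (if l == 1 then dbspc p a2 N else bspc p a2 N) ((k %/ m1) %% m2)%N (c2 x)
  * (if l == 2 then dbspc p a3 N else bspc p a3 N) (k %/ (m1 * m2))%N (c3 x).

Lemma tpd_continuous l k : continuous (tpd l k).
Proof.
move=> x; apply: cvgM; first apply: cvgM.
- apply: (@continuous_comp _ _ _ (@c1 R)); first exact: c1_continuous.
  by case: eqP => _; [exact: dbspc_continuous|exact: bspc_continuous].
- apply: (@continuous_comp _ _ _ (@c2 R)); first exact: c2_continuous.
  by case: eqP => _; [exact: dbspc_continuous|exact: bspc_continuous].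
- apply: (@continuous_comp _ _ _ (@c3 R)); first exact: c3_continuous.
  by case: eqP => _; [exact: dbspc_continuous|exact: bspc_continuous].
Qed.

Lemma tp_basisE k x : cube x -> tp_basis p a1 a2 a3 N k x = tpd 3 k x.
Proof. by case=> *; rewrite /tp_basis !bspcE. Qed.

Lemma derive1_tp_sum (n : nat) (c : 'I_n -> R) (h : pt R -> R) :
  (forall x, cube x -> h x = \sum_(j < n) c j * tp_basis p a1 a2 a3 N j x) ->
  forall l : 'I_3,
  (forall x, cube x -> derivable (fun s => h (upd l x s)) (coord l x) 1) ->
  forall x, cube x ->
    ((fun s => h (upd l x s))^`())%classic (coord l x) = \sum_(j < n) c j * tpd l j x.
Proof.
move=> hE l dh x cx; have /cube_coord xl := cx.
have dh' s : 0 <= s <= 1 -> derivable (fun s => h (upd l x s)) s 1.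
  move=> s01; have := dh _ (cube_upd l cx s01).
  by rewrite coord_upd eqxx; under eq_fun do rewrite upd_upd.
have hE' s : 0 <= s <= 1 ->
    h (upd l x s) = \sum_(j < n) c j * tp_basis p a1 a2 a3 N j (upd l x s).
  by move=> s01; rewrite hE//; exact: cube_upd.
case: cx => x1 x2 x3.
case: l dh dh' hE' {hE} => [[|[|[|//]]] i] dh dh' hE'.
- rewrite (derive1_bsp_sum ap1 N0 (c := fun j => c j * (bspc p a2 N ((j %/ m1) %% m2)%N (c2 x)
               * bspc p a3 N (j %/ (m1 * m2))%N (c3 x)))
     (f := fun j : 'I_n => (j %% m1)%N) _ dh')//.
    by apply: eq_bigr => j _; rewrite /tpd /=; ring.
  move=> s s01; rewrite hE'//; apply: eq_bigr => j _.
  by rewrite /tp_basis /= -!bspcE//; ring.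
- rewrite (derive1_bsp_sum ap2 N0 (c := fun j => c j * (bspc p a1 N (j %% m1)%N (c1 x)
               * bspc p a3 N (j %/ (m1 * m2))%N (c3 x)))
     (f := fun j : 'I_n => ((j %/ m1) %% m2)%N) _ dh')//.
    by apply: eq_bigr => j _; rewrite /tpd /=; ring.
  move=> s s01; rewrite hE'//; apply: eq_bigr => j _.
  by rewrite /tp_basis /= -!bspcE//; ring.
- rewrite (derive1_bsp_sum ap3 N0 (c := fun j => c j * (bspc p a1 N (j %% m1)%N (c1 x)
               * bspc p a2 N ((j %/ m1) %% m2)%N (c2 x)))
     (f := fun j : 'I_n => (j %/ (m1 * m2))%N) _ dh')//.
    by apply: eq_bigr => j _; rewrite /tpd /=; ring.
  move=> s s01; rewrite hE'//; apply: eq_bigr => j _.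
  by rewrite /tp_basis /= -!bspcE//; ring.
Qed.

(** One direction is peeled off at a time, with the remaining variables frozen. The three digits
    determine [j], so the last fibre contains nothing else. *)
Lemma tp_free (c : 'I_(tp_dim p a1 a2 a3 N) -> R) :
  (forall x, cube x -> \sum_j c j * tp_basis p a1 a2 a3 N j x = 0) ->
  forall j, c j = 0.
Proof.
move=> H j; pose n := tp_dim p a1 a2 a3 N.
have m10 : (0 < m1)%N by [].
have m20 : (0 < m2)%N by [].
have H1 y z : 0 <= y <= 1 -> 0 <= z <= 1 ->
    \sum_(k < n | (k %% m1 == j %% m1)%N)
      c k * bsp p a2 N ((k %/ m1) %% m2)%N y * bsp p a3 N (k %/ (m1 * m2))%N z = 0.
  move=> y01 z01; apply: (bsp_free_partition ap1 N0 (A := xpredT)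
    (f := fun k : 'I_n => (k %% m1)%N)) => [i _|x x01].
    by rewrite ltn_mod.
  rewrite -[RHS](H (x, y, z))//; apply: eq_bigr => k _.
  by rewrite /tp_basis /c1 /c2 /c3 /=; ring.
have H2 z : 0 <= z <= 1 ->
    \sum_(k < n | (k %% m1 == j %% m1)%N && ((k %/ m1) %% m2 == (j %/ m1) %% m2)%N)
      c k * bsp p a3 N (k %/ (m1 * m2))%N z = 0.
  move=> z01; apply: (bsp_free_partition ap2 N0 (A := fun k : 'I_n => (k %% m1 == j %% m1)%N)
    (f := fun k : 'I_n => ((k %/ m1) %% m2)%N)) => [i _|y y01].
    by rewrite ltn_mod.
  rewrite -[RHS](H1 y z)//; apply: eq_bigr => k _.
  by ring.
have H3 : \sum_(k < n | (k %% m1 == j %% m1)%N && ((k %/ m1) %% m2 == (j %/ m1) %% m2)%N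
     && (k %/ (m1 * m2) == j %/ (m1 * m2))%N) c k = 0.
  apply: (bsp_free_partition ap3 N0 (A := fun k : 'I_n => (k %% m1 == j %% m1)%N
     && ((k %/ m1) %% m2 == (j %/ m1) %% m2)%N)
    (f := fun k : 'I_n => (k %/ (m1 * m2))%N)) => [i _|z z01].
    by rewrite ltn_divLR ?muln_gt0 ?m10// mulnC; apply: ltn_ord.
  exact: H2.
rewrite -[RHS]H3 (big_pred1 j)// => k /=.
apply/idP/eqP => [/andP[/andP[/eqP e1 /eqP e2] /eqP e3]|->]; last by rewrite !eqxx.
apply/val_inj; rewrite /= (divn_eq k m1) (divn_eq j m1) e1; congr (_ * _ + _)%N.
by rewrite (divn_eq (k %/ m1) m2) (divn_eq (j %/ m1) m2) e2 -!divnMA e3.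
Qed.

End TensorBasis.

(** * The geometry map is bi-Lipschitz *)

Section CompactLocal.
Variable R : realType.

(** The usual minimum over a finite subcover. It appears as a near-covering argument in which [c]
    runs along the filter of positive numbers tending to 0: by monotonicity [Q] holds for all small
    enough [c]. *)
Lemma compact_uniform_const (T : topologicalType) (K : set T) (Q : R -> T -> Prop) :
  compact K ->
  (forall c c' x, 0 < c' -> c' <= c -> Q c x -> Q c' x) ->
  (forall x, K x -> exists2 c, 0 < c & \forall x' \near x, K x' -> Q c x') ->
  exists2 c, 0 < c & forall x, K x -> Q c x.
Proof.
move=> /compact_near_coveringP/near_covering_withinP cK mQ lQ.
have := cK => /(_ R (0^'+) (fun c x => Q c x) _)[x Kx|e /= e0 He].
  have [c c0 Hc] := lQ x Kx.
  exists ((fun x' => K x' -> Q c x'), (fun c' => 0 < c' /\ c' <= c)) => /=.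
    split => //; near=> c'; split; near: c'; first exact: nbhs_right_gt.
    exact: nbhs_right_le.
  move=> [x' c'] /= [h [c'0 c'c]] Kx'; apply: mQ c'0 c'c _; exact: h.
exists (e / 2); first by rewrite divr_gt0.
apply: He => /=; last by rewrite divr_gt0.
by rewrite /ball_ sub0r normrN gtr0_norm ?divr_gt0// ltr_pdivrMr// ltr_pMr// ltr1n.
Unshelve. all: by end_near. Qed.

(** The uniform constant is the inverse of the bound, so that decreasing it weakens the claim. *)
Lemma compact_bound (T : topologicalType) (K : set T) (f : T -> R) :
  compact K -> continuous f -> exists2 B, 0 < B & forall x, K x -> `|f x| <= B.
Proof.
move=> cK cf.
have [c c0 Hc] : exists2 c, 0 < c & forall x, K x -> `|f x| <= c^-1.
  apply: (compact_uniform_const cK).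
    move=> c c' x c'0 c'c /le_trans; apply; rewrite lef_pV2 ?posrE//.
    exact: lt_le_trans c'c.
  move=> x _; exists (`|f x| + 1)^-1; first by rewrite invr_gt0 ltr_wpDl.
  rewrite invrK.
  have /cvgr_norm_le : f @ x --> f x by exact: cf.
  have xl : `|f x| < `|f x| + 1 by rewrite ltrDl.
  by move=> /(_ _ xl); apply: filterS => x' h _.
by exists c^-1 => //; rewrite invr_gt0.
Qed.

Lemma compact_bound_away (T : topologicalType) (K : set T) (f : T -> R) :
  compact K -> continuous f -> (forall x, K x -> f x != 0) ->
  exists2 c, 0 < c & forall x, K x -> c <= `|f x|.
Proof.
move=> cK cf f0; apply: (compact_uniform_const cK).
  by move=> c c' x _; exact: le_trans.
move=> x Kx; have fx : 0 < `|f x| by rewrite normr_gt0 f0.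
exists (`|f x| / 2); first by rewrite divr_gt0.
have /cvgr_norm_ge : f @ x --> f x by exact: cf.
have x2 : `|f x| / 2 < `|f x| by rewrite ltr_pdivrMr// ltr_pMr// ltr1n.
move=> /(_ _ x2).
by apply: filterS => x' h _.
Qed.

Lemma continuous_prodr (T : topologicalType) (I : Type) (r : seq I)
    (f : I -> T -> R) : (forall i, continuous (f i)) ->
  continuous (fun x => \prod_(i <- r) f i x).
Proof.
move=> cf; elim: r => [|i r IH].
  by under eq_fun do rewrite big_nil; move=> x; exact: cvg_cst.
under eq_fun do rewrite big_cons.
by move=> x; apply: cvgM; [exact: cf|exact: IH].
Qed.

Lemma continuous_det (T : topologicalType) n (M : 'I_n -> 'I_n -> T -> R) :
  (forall i j, continuous (M i j)) -> continuous (fun x => \det (\matrix_(i, j) M i j x)).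
Proof.
move=> cM; rewrite /determinant.
under eq_fun do under eq_bigr do under eq_bigr do rewrite mxE.
apply: continuous_sumr => s x; apply: cvgM; first exact: cvg_cst.
exact: (@continuous_prodr T _ (index_enum 'I_n) _ (fun i => cM i _) x).
Qed.

End CompactLocal.

Section PtNorm.
Variable R : realType.
Implicit Types (x y : pt R).

Lemma coordB k x y : coord k (x - y) = coord k x - coord k y.
Proof. by case: k => [[|[|[|//]]] i]. Qed.

Lemma pt_norm_le x r : (`|x| <= r) <-> (forall k, `|coord k x| <= r).
Proof.
case: x => [[x1 x2] x3]; rewrite !prod_normE /= !ge_max; split.
  by move=> /andP[/andP[h1 h2] h3] [[|[|[|//]]] i].
by move=> h; rewrite (h ord0) (h (@Ordinal 3 1 isT)) (h ord_max).
Qed.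

Lemma coord_le_norm k x : `|coord k x| <= `|x|.
Proof. by have /pt_norm_le := lexx `|x|. Qed.

Lemma cubeE : @cube R = (`[0, 1] `*` `[0, 1]) `*` `[0, 1].
Proof.
apply/seteqP; split => [[[x y] z] [] /= h1 h2 h3|[[x y] z] /= [[]]];
  by rewrite !in_itv /=.
Qed.

Lemma cube_compact : compact (@cube R).
Proof.
by rewrite cubeE; do !apply: compact_setX; exact: segment_compact.
Qed.

Lemma cube_dist x y : cube x -> cube y -> `|x - y| <= 1.
Proof.
move=> /cube_coord cx /cube_coord cy; apply/pt_norm_le => k; rewrite coordB ler_norml.
by have /andP[? ?] := cx k; have /andP[? ?] := cy k; apply/andP; split; lra.
Qed.

End PtNorm.

Section Bilipschitz.
Variable R : realType.
Variables (G : pt R -> pt R) (g : 'I_3 -> pt R -> R) (D : 'I_3 -> 'I_3 -> pt R -> R).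
Hypothesis gE : forall k x, cube x -> coord k (G x) = g k x.
Hypothesis g_cont : forall k, continuous (g k).
Hypothesis D_cont : forall k l, continuous (D k l).
Hypothesis Gder : forall k l x, cube x ->
  is_derive (coord l x) 1 (fun s => coord k (G (upd l x s))) (D k l x).

Lemma coordinate_mean_value k l x s : cube x -> 0 <= s <= 1 ->
  exists s', [/\ 0 <= s' <= 1, `|s' - coord l x| <= `|s - coord l x| &
    coord k (G (upd l x s)) - coord k (G x) = D k l (upd l x s') * (s - coord l x)].
Proof.
move=> cx s01; have /cube_coord/(_ l) x01 := cx.
pose h s := coord k (G (upd l x s)).
have hx : coord k (G x) = h (coord l x) by rewrite /h upd_id.
have dh (t : R) : 0 <= t <= 1 -> is_derive t 1 h (D k l (upd l x t)).
  move=> t01; have := Gder k l (cube_upd l cx t01).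
  by rewrite coord_upd eqxx; under eq_fun do rewrite upd_upd.
have main (a b : R) : 0 <= a <= 1 -> 0 <= b <= 1 -> a <= b ->
    exists2 c, a <= c <= b & h b - h a = D k l (upd l x c) * (b - a).
  move=> /andP[a0 a1] /andP[b0 b1] ab.
  have in01 (t : R) : a <= t <= b -> 0 <= t <= 1.
    by case/andP=> at_ tb; rewrite (le_trans a0)//= (le_trans tb).
  have [||c] := @MVT_segment R h (fun t => D k l (upd l x t)) a b ab.
  - by move=> t; rewrite in_itv /= => /andP[/ltW ta /ltW tb]; apply/dh/in01/andP.
  - apply: derivable_within_continuous => t; rewrite in_itv /= => /in01 t01.
    exact: (@ex_derive _ _ _ _ _ _ _ (dh t t01)).
  - by rewrite in_itv /= => cab hc; exists c.
have [xs|sx] := leP (coord l x) s.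
  have [c /andP[xc cs] hc] := main _ _ x01 s01 xs.
  exists c; split; last by rewrite hx -hc.
    by have /andP[? ?] := x01; have /andP[? ?] := s01; apply/andP; split; lra.
  by rewrite !ger0_norm ?subr_ge0// lerB.
have [c /andP[xc cs] hc] := main _ _ s01 x01 (ltW sx).
exists c; split.
- by have /andP[? ?] := x01; have /andP[? ?] := s01; apply/andP; split; lra.
- by rewrite !ler0_norm ?subr_le0 ?(ltW sx)// lerN2 lerB.
- by rewrite hx -[LHS]opprB [in LHS]/= -/(h s) hc; ring.
Qed.

(** The path [y], [y1], [y2], [x] changes one coordinate at a time and stays in the cube because the
    cube is a box; [w l] is the start of its leg [l]. Each component [k] on each leg has its own
    intermediate point. *)
Lemma mean_value x y : cube x -> cube y -> exists xi : 'I_3 -> 'I_3 -> pt R,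
  (forall k l, cube (xi k l) /\ `|xi k l - y| <= `|x - y|) /\
  forall k, coord k (G x) - coord k (G y)
    = \sum_l D k l (xi k l) * (coord l x - coord l y).
Proof.
move=> cx cy.
pose y1 := upd (@Ordinal 3 0 isT) y (c1 x).
pose y2 := upd (@Ordinal 3 1 isT) y1 (c2 x).
pose w (l : 'I_3) := if val l == 0%N then y else if val l == 1%N then y1 else y2.
have cy1 : cube y1 by case: cx => *; exact: cube_upd.
have cy2 : cube y2 by case: cx => *; exact: cube_upd.
have wx l : upd l (w l) (coord l x) =
    (if val l == 0%N then y1 else if val l == 1%N then y2 else x).
  by case: l => [[|[|[|//]]] i] //; case: x @y1 @y2 @w {cx cy1 cy2} => [[]].
have wy l : coord l (w l) = coord l y by case: l => [[|[|[|//]]] i].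
have cw l : cube (w l) by case: l => [[|[|[|//]]] i].
have wn l : `|w l - y| <= `|x - y|.
  apply/pt_norm_le => k; have := coord_le_norm k (x - y); rewrite !coordB.
  by apply: le_trans; case: l => [[|[|[|//]]] i]; case: k => [[|[|[|//]]] j];
    rewrite ?subrr ?normr0 ?normr_ge0.
have /cube_coord x01 := cx.
have mv (kl : 'I_3 * 'I_3) : exists s', [/\ 0 <= s' <= 1,
    `|s' - coord kl.2 y| <= `|coord kl.2 x - coord kl.2 y| &
    coord kl.1 (G (upd kl.2 (w kl.2) (coord kl.2 x))) - coord kl.1 (G (w kl.2))
     = D kl.1 kl.2 (upd kl.2 (w kl.2) s') * (coord kl.2 x - coord kl.2 y)].
  by have := coordinate_mean_value kl.1 kl.2 (cw kl.2) (x01 kl.2); rewrite wy.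
have [s Hs] := choice mv.
exists (fun k l => upd l (w l) (s (k, l))); split.
  move=> k l; have [s01 sn _] := Hs (k, l); split; first exact: cube_upd.
  apply/pt_norm_le => j; rewrite coordB coord_upd; case: eqP => [->|_].
    by rewrite (le_trans sn)// -coordB coord_le_norm.
  by rewrite -coordB (le_trans (coord_le_norm _ _)).
move=> k; rewrite !big_ord_recl big_ord0 addr0.
have H l := let: And3 _ _ h := Hs (k, l) in h.
rewrite /= in H; rewrite -!H !wx /=; ring.
Qed.

Lemma lipschitz_cube : exists2 L, 0 < L &
  forall x y, cube x -> cube y -> `|G x - G y| <= L * `|x - y|.
Proof.
have /choice[B HB] : forall kl : 'I_3 * 'I_3, exists B, 0 < B /\
    forall x, cube x -> `|D kl.1 kl.2 x| <= B.
  move=> kl; have [B B0 HB] := compact_bound (@cube_compact R) (D_cont (k:=kl.1) (l:=kl.2)).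
  by exists B.
pose L := 1 + \sum_k \sum_l B (k, l).
have sB k : 0 <= \sum_l B (k, l).
  by apply: sumr_ge0 => l _; apply/ltW/(HB (k, l)).1.
exists L; first by rewrite ltr_pwDl// sumr_ge0.
move=> x y cx cy; have [xi [xi1 xi2]] := mean_value cx cy.
apply/pt_norm_le => k; rewrite coordB xi2 (le_trans (ler_norm_sum _ _ _))//.
apply: (@le_trans _ _ (\sum_l B (k, l) * `|x - y|)).
  apply: ler_sum => l _; rewrite normrM ler_pM//.
    by apply: (HB (k, l)).2; exact: (xi1 k l).1.
  by rewrite -coordB coord_le_norm.
rewrite -mulr_suml ler_wpM2r// /L [X in _ <= 1 + X](bigD1 k)//= addrCA lerDl addr_ge0// sumr_ge0//.
Qed.

Hypothesis detD : forall x, cube x -> \det (\matrix_(k, l) D k l x) != 0.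
Hypothesis Ginj : forall x y, cube x -> cube y -> G x = G y -> x = y.

(* Near the diagonal, J(z) (x - y) = (G x - G y) - E (x - y) with E small. *)
Lemma colipschitz_diag (z : pt R) : cube z -> exists2 c, 0 < c &
  \forall p \near (z, z), ((@cube R) `*` (@cube R)) p -> c * `|p.1 - p.2| <= `|G p.1 - G p.2|.
Proof.
move=> cz; set A := \matrix_(k, l) D k l z.
pose V := invmx A; have VA : V *m A = 1%:M.
  by apply: mulVmx; rewrite unitmxE unitfE; exact: detD.
pose b := 1 + \sum_i \sum_k `|V i k|.
have b0 : 0 < b by rewrite ltr_pwDl// !sumr_ge0// => i _; rewrite sumr_ge0.
have Vb i : \sum_k `|V i k| <= b.
  rewrite /b [X in _ <= 1 + X](bigD1 i)//= addrCA lerDl addr_ge0// sumr_ge0// => *.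
  exact: sumr_ge0.
(* Three errors of size [e * n], multiplied by the bound [b] on the inverse, amount to [n / 2],
   which the left-hand side absorbs. *)
pose e := (6 * b)^-1; have e0 : 0 < e by rewrite invr_gt0 mulr_gt0.
have [d d0 Hd] : exists2 d, 0 < d & forall k l x, `|x - z| < d -> `|D k l x - D k l z| <= e.
  have : \forall x \near z, forall k l, `|D k l x - D k l z| <= e.
    apply: (filter_forall (nbhs_filter z)) => k.
    apply: (filter_forall (nbhs_filter z)) => l.
    have /cvgrPdist_le/(_ e e0) : D k l @ z --> D k l z by exact: D_cont.
    by apply: filterS => x; rewrite distrC.
  case/nbhs_ballP => d /= d0 Hd; exists d => // k l x xd.
  by apply: Hd; rewrite prod_norm_ball /ball_ /= distrC.
exists (2 * b)^-1; first by rewrite invr_gt0 mulr_gt0.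
(* Radius [d / 3], since an intermediate point is within [|x - y| + |y - z|] of [z], and this is
   less than [2 * d / 3 + d / 3]. *)
exists (ball z (d / 3), ball z (d / 3)) => /=.
  by split; apply: nbhsx_ballx; rewrite divr_gt0.
move=> [x y] /=; rewrite prod_norm_ball /ball_ /= => -[zx zy] [cx cy].
have xyd : `|x - y| < d / 3 + d / 3.
  rewrite (_ : x - y = (x - z) + (z - y)); last by rewrite addrA subrK.
  by rewrite (le_lt_trans (ler_normD _ _))// ltrD// distrC.
have [xi [xi1 xi2]] := mean_value cx cy.
set n := `|x - y| in xyd xi1 *; set m := `|G x - G y|.
have E k l : `|D k l (xi k l) - A k l| <= e.
  rewrite mxE; apply: Hd.
  rewrite (_ : xi k l - z = (xi k l - y) + (y - z)); last by rewrite addrA subrK.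
  rewrite (le_lt_trans (ler_normD _ _))//.
  by have := (xi1 k l).2; rewrite (distrC y z); lra.
have key i : coord i x - coord i y = \sum_k V i k *
    ((coord k (G x) - coord k (G y))
     - \sum_l (D k l (xi k l) - A k l) * (coord l x - coord l y)).
  have -> : coord i x - coord i y = \sum_l (V *m A) i l * (coord l x - coord l y).
    rewrite VA (bigD1 i)//= !mxE eqxx mul1r big1 ?addr0// => l li.
    by rewrite mxE eq_sym (negbTE li) mul0r.
  under eq_bigr do rewrite mxE mulr_suml.
  rewrite exchange_big; apply: eq_bigr => k _ /=; rewrite xi2 -sumrB mulr_sumr.
  by apply: eq_bigr => l _; ring.
have bound i : `|coord i x - coord i y| <= b * (m + 3 * e * n).
  rewrite key (le_trans (ler_norm_sum _ _ _))//.
  have mn : 0 <= m + 3 * e * n by rewrite addr_ge0 ?mulr_ge0 ?normr_ge0// ltW.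
  apply: (@le_trans _ _ (\sum_k `|V i k| * (m + 3 * e * n))); last first.
    by rewrite -mulr_suml ler_wpM2r.
  apply: ler_sum => k _; rewrite normrM ler_wpM2l// (le_trans (ler_normB _ _))//.
  apply: lerD; first by rewrite -coordB coord_le_norm.
  rewrite (le_trans (ler_norm_sum _ _ _))//.
  apply: (@le_trans _ _ (\sum_(l < 3) e * n)).
    apply: ler_sum => l _; rewrite normrM ler_pM//.
    by rewrite -coordB coord_le_norm.
  by rewrite sumr_const card_ord; lra.
have nb : n <= b * (m + 3 * e * n).
  by apply/pt_norm_le => i; rewrite coordB.
have be : b * (3 * e * n) = n / 2 by rewrite /e; field; rewrite gt_eqF.
have {}nb : n / 2 <= b * m by move: nb; rewrite mulrDr be; lra.
by rewrite mulrC ler_pdivrMr ?mulr_gt0//; lra.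
Qed.

Lemma colipschitz_cube : exists2 c, 0 < c &
  forall x y, cube x -> cube y -> c * `|x - y| <= `|G x - G y|.
Proof.
have cc : compact ((@cube R) `*` (@cube R)).
  by apply: compact_setX; exact: cube_compact.
have [] := @compact_uniform_const R _ _
    (fun c p => c * `|p.1 - p.2| <= `|G p.1 - G p.2|) cc.
- by move=> c c' p _ c'c; apply: le_trans; rewrite ler_wpM2r.
- move=> [u v] [/= cu cv]; have [<-|uv] := eqVneq u v; first exact: colipschitz_diag.
  have [k guv] : exists k, g k u - g k v != 0.
    apply/existsP; apply: contraNT uv; rewrite negb_exists => /forallP h.
    apply/eqP/Ginj => //; apply: coord_inj => k; rewrite !gE//.
    by apply/eqP; rewrite -subr_eq0; have := h k; rewrite negbK.
  have n0 : 0 < `|g k u - g k v| by rewrite normr_gt0.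
  (* Half of the gap persists near [(u, v)], and two points of the cube are at distance at most
     1. *)
  exists (`|g k u - g k v| / 2); first by rewrite divr_gt0.
  have cf : (fun p : pt R * pt R => g k p.1 - g k p.2) @ (u, v) --> g k u - g k v.
    apply: cvgB.
      by apply: (@cvg_comp _ _ _ fst (g k) (nbhs (u, v)) (nbhs u)); [exact: cvg_fst|exact: g_cont].
    by apply: (@cvg_comp _ _ _ snd (g k) (nbhs (u, v)) (nbhs v)); [exact: cvg_snd|exact: g_cont].
  have /cvgr_norm_ge := cf.
  have x2 : `|g k u - g k v| / 2 < `|g k u - g k v|.
    by rewrite ltr_pdivrMr// ltr_pMr// ltr1n.
  move=> /(_ _ x2).
  apply: filterS => -[x y] /= h [/= cx cy].
  rewrite (le_trans _ (coord_le_norm k _))// coordB !gE// (le_trans _ h)//.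
  by rewrite ler_piMr ?divr_ge0// cube_dist.
- by move=> c c0 h; exists c => // x y cx cy; exact: (h (x, y)).
Qed.

End Bilipschitz.

(** [dJ] is the determinant of the glued partial derivatives, continuous on the whole space. A
    single [L] serves all bounds, being the sum of the individual constants. *)
Lemma spline_map_bilipschitz (R : realType) (G : pt R -> pt R) :
  spline_map G -> {in cube (R:=R) &, injective G} ->
  (forall x, cube x -> forall k l : 'I_3, partial_exists G k l x) ->
  (forall x, cube x -> detJ G x != 0) ->
  exists (L : R) (dJ : pt R -> R), [/\ 0 < L,
    forall x y, cube x -> cube y -> `|G x - G y| <= L * `|x - y|,
    forall x y, cube x -> cube y -> `|x - y| <= L * `|G x - G y|,
    continuous dJ &
    forall x, cube x -> detJ G x = dJ x /\ L^-1 <= `|dJ x| <= L].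
Proof.
move=> [p [a1 [a2 [a3 [N [cf [ap1 ap2 ap3 N0 GE]]]]]]] Ginj Gder Gdet.
pose n := tp_dim p a1 a2 a3 N.
pose g k x := \sum_(j < n) coord k (cf j) * tpd p a1 a2 a3 N 3 j x.
pose D (k l : 'I_3) x := \sum_(j < n) coord k (cf j) * tpd p a1 a2 a3 N l j x.
have cts c l : continuous (fun x : pt R => \sum_(j < n) c j * tpd p a1 a2 a3 N l j x).
  apply: continuous_sumr => j x; apply: cvgM; first exact: cvg_cst.
  exact: tpd_continuous.
have gE k x : cube x -> coord k (G x) = g k x.
  by move=> cx; rewrite GE//; apply: eq_bigr => j _; rewrite tp_basisE.
have dE k l x : cube x -> partialG G k l x = D k l x.
  by move=> cx; rewrite /partialG (derive1_tp_sum ap1 ap2 ap3 N0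
    (h := fun x => coord k (G x)) (c := fun j : 'I_n => coord k (cf j)))//;
    move=> y cy; [exact: GE|exact: Gder].
have Gd k l x : cube x ->
    is_derive (coord l x) 1 (fun s => coord k (G (upd l x s))) (D k l x).
  by move=> cx; rewrite -dE// /partialG derive1E; apply: DeriveDef => //; exact: Gder.
pose dJ x := \det (\matrix_(k, l) D k l x).
have dJE x : cube x -> detJ G x = dJ x.
  by move=> cx; congr (\det _); apply/matrixP => k l; rewrite !mxE dE.
have dJc : continuous dJ by apply: continuous_det => k l; exact: cts.
have dJ0 x : cube x -> dJ x != 0 by move=> cx; rewrite -dJE// Gdet.
have [L1 L10 H1] := lipschitz_cube (fun k l => @cts _ _) Gd.
have Ginj' x y : cube x -> cube y -> G x = G y -> x = y.
  by move=> cx cy; apply: Ginj; exact/mem_set.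
have [c c0 H2] := colipschitz_cube gE (fun k => @cts _ _) (fun k l => @cts _ _) Gd dJ0 Ginj'.
have [B B0 H3] := compact_bound (@cube_compact R) dJc.
have [m m0 H4] := compact_bound_away (@cube_compact R) dJc dJ0.
have ic0 : 0 < c^-1 by rewrite invr_gt0.
have im0 : 0 < m^-1 by rewrite invr_gt0.
have L0 : 0 < L1 + c^-1 + B + m^-1 by rewrite !addr_gt0.
exists (L1 + c^-1 + B + m^-1), dJ; split=> // [x y cx cy|x y cx cy|x cx].
- by rewrite (le_trans (H1 _ _ cx cy))// ler_wpM2r//; lra.
- apply: (@le_trans _ _ (c^-1 * `|G x - G y|)).
    by rewrite ler_pdivlMl// H2.
  by rewrite ler_wpM2r//; lra.
split; first exact: dJE.
apply/andP; split; last by rewrite (le_trans (H3 _ cx))//; lra.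
by rewrite (le_trans _ (H4 _ cx))// invf_ple ?posrE//; lra.
Qed.

(** * Integrals under Lipschitz maps *)

Section PtMeasure.
Variable R : realType.
Implicit Types (A U : set (pt R)) (x y : pt R).

Lemma leb3X (A B C : set R) : measurable A -> measurable B -> measurable C ->
  leb3 ((A `*` B) `*` C) = (lebesgue_measure A * lebesgue_measure B * lebesgue_measure C)%E.
Proof.
move=> mA mB mC; rewrite /leb3 product_measure1E//; last exact: measurableX.
by congr (_ * _)%E; exact: product_measure1E.
Qed.

Lemma measurable_box (A B C : set R) : measurable A -> measurable B -> measurable C ->
  measurable ((A `*` B) `*` C : set (pt R)).
Proof. by move=> mA mB mC; apply: measurableX => //; exact: measurableX. Qed.

Definition cbox x (r : R) : set (pt R) :=
  (`[c1 x - r, c1 x + r] `*` `[c2 x - r, c2 x + r]) `*` `[c3 x - r, c3 x + r].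

Lemma cboxP x r y : cbox x r y <-> `|y - x| <= r.
Proof.
have h (a b : R) : (`[b - r, b + r]%classic a : Prop) = (`|a - b| <= r).
  rewrite /= in_itv /= ler_norml; congr is_true.
  by apply/idP/idP => /andP[? ?]; apply/andP; split; lra.
rewrite /cbox; split=> [[[h1 h2] h3]|/pt_norm_le H].
  move: h1 h2 h3; rewrite !h => h1 h2 h3; apply/pt_norm_le.
  by move=> [[|[|[|//]]] i]; rewrite coordB.
have := H ord0; have := H (@Ordinal 3 1 isT); have := H ord_max.
by rewrite !coordB => h3 h2 h1; split; [split|]; rewrite h.
Qed.

Lemma measurable_cbox x r : measurable (cbox x r).
Proof. by apply: measurable_box; exact: measurable_itv. Qed.

Lemma leb3_cbox x r : 0 <= r -> leb3 (cbox x r) = ((2 * r) ^+ 3)%:E.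
Proof.
move=> r0; have li (b : R) : lebesgue_measure (`[b - r, b + r] : set R) = (2 * r)%:E.
  rewrite lebesgue_measure_itv /= lte_fin.
  case: ltP => [_|h]; first by rewrite -EFinD; congr EFin; ring.
  by congr EFin; move: h r0; lra.
rewrite leb3X; try exact: measurable_itv.
by rewrite !li -!EFinM exprSr expr2.
Qed.

(** Measurability on [pt] refers to a product sigma-algebra. An open set is the union of the
    countably many closed cubes inside it with rational centre and radius [1 / (n + 1)]. *)
Lemma open_measurable_pt U : open U -> measurable U.
Proof.
move=> oU; pose I := ((rat * rat) * rat * nat)%type.
pose q (i : I) : pt R := (ratr i.1.1.1, ratr i.1.1.2, ratr i.1.2).
pose F (i : I) : set (pt R) :=
  if `[< cbox (q i) i.2.+1%:R^-1 `<=` U >] then cbox (q i) i.2.+1%:R^-1 else set0.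
have -> : U = \bigcup_i F i.
  apply/seteqP; split => [x Ux|x [i _]]; last first.
    by rewrite /F; case: ifPn => // /asboolP; apply.
  have : nbhs x U by exact: open_nbhs_nbhs.
  case/nbhs_ballP => e /= e0 He.
  have [n ne] : exists n : nat, n.+1%:R^-1 < e / 2.
    have := near_infty_natSinv_lt (PosNum (divr_gt0 e0 (ltr0Sn R 1))).
    by move=> [n _ /(_ n) /= H]; exists n; apply: H => /=.
  have n0 : 0 < n.+1%:R^-1 :> R by rewrite invr_gt0.
  set r := n.+1%:R^-1 in ne n0 *.
  have rq (a : R) : exists q : rat, `|a - ratr q| <= r.
    have [|q0] := @rat_in_itvoo R (a - r) (a + r).
      by rewrite ltrD2l (lt_trans _ n0)// oppr_lt0.
    rewrite in_itv /= => /andP[h1 h2]; exists q0; rewrite ler_norml.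
    by apply/andP; split; lra.
  have [q1 h1] := rq (c1 x); have [q2 h2] := rq (c2 x); have [q3 h3] := rq (c3 x).
  have xq : `|x - (ratr q1, ratr q2, ratr q3)| <= r.
    by apply/pt_norm_le => -[[|[|[|//]]] i]; rewrite coordB.
  exists (q1, q2, q3, n) => //; rewrite /F; case: ifPn; first by move=> _; apply/cboxP.
  case/asboolP => y /cboxP /= hy; apply: He.
  rewrite prod_norm_ball /ball_ /=.
  rewrite (_ : x - y = (x - (ratr q1, ratr q2, ratr q3)) + ((ratr q1, ratr q2, ratr q3) - y)); last by rewrite addrA subrK.
  rewrite (le_lt_trans (ler_normD _ _))// (distrC _ y).
  by rewrite /q /= -/r in hy; lra.
apply: countable_bigcupT_measurable => [|i]; first exact: countableP.
by rewrite /F; case: ifP => _; [exact: measurable_cbox|exact: measurable0].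
Qed.

Lemma compact_measurable_pt A : compact A -> measurable A.
Proof.
move=> cA; rewrite -(setCK A); apply: measurableC; apply: open_measurable_pt.
by apply: closed_openC; apply: compact_closed cA; exact: norm_hausdorff.
Qed.

(** Functions such as [h \o Ginv G] are controlled only on [Omega G], since [Ginv] takes a default
    value elsewhere; the epsilon-delta form composes directly with Lipschitz bounds. *)
Definition cont_on A (f : pt R -> R) := forall x, A x -> forall e, 0 < e ->
  exists2 d, 0 < d & forall y, A y -> `|x - y| < d -> `|f x - f y| <= e.

Lemma continuous_cont_on A f : continuous f -> cont_on A f.
Proof.
move=> cf x _ e e0; have /cvgrPdist_le/(_ e e0) : f @ x --> f x by exact: cf.
case/nbhs_ballP => d /= d0 Hd; exists d => // y _ xy; apply: Hd.
by rewrite prod_norm_ball.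
Qed.

Lemma cont_on_comp A (B : set (pt R)) (f : pt R -> R) (F : pt R -> pt R) (L : R) :
  0 < L -> (forall x, A x -> B (F x)) ->
  (forall x y, A x -> A y -> `|F x - F y| <= L * `|x - y|) ->
  cont_on B f -> cont_on A (f \o F).
Proof.
move=> L0 AB HF cf x Ax e e0; have [d d0 Hd] := cf _ (AB _ Ax) e e0.
exists (d / L); first by rewrite divr_gt0.
move=> y Ay xy; apply: Hd; first exact: AB.
by rewrite (le_lt_trans (HF _ _ Ax Ay))// mulrC -ltr_pdivlMr.
Qed.

Lemma cont_on_measurable A f : measurable A -> cont_on A f -> measurable_fun A f.
Proof.
move=> mA cf; move=> _; apply: (measurability _ (RGenOInfty.measurableE R)) => //.
move=> _ [_ [r ->] <-].
have -> : A `&` f @^-1` `]r, +oo[ = A `&` interior [set y | A y -> r < f y].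
  apply/seteqP; split => x [Ax]; rewrite /= in_itv /= andbT => h; split => //.
    have e0 : 0 < (f x - r) / 2 by rewrite divr_gt0// subr_gt0.
    have [d d0 Hd] := cf x Ax _ e0; apply/nbhs_ballP; exists d => //= y.
    rewrite prod_norm_ball /ball_ /= => xy Ay; have := Hd _ Ay xy.
    by rewrite ler_norml => /andP[_]; lra.
  by have /nbhs_singleton := h; exact.
by apply: measurableI => //; apply: open_measurable_pt; exact: open_interior.
Qed.

End PtMeasure.

(** * Half-open grids and step functions *)

Section Grid.
Variable R : realType.

Definition gcell (a w : R) (i : nat) : set R := `[a + w * i%:R, a + w * i.+1%:R[.

Lemma gcell_indic_sum (a w : R) N (x : R) : 0 <= w -> a <= x < a + w * N%:R ->
  \sum_(i < N) \1_(gcell a w i) x = 1 :> R.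
Proof.
move=> w0 /andP[ax xN]; pose f (i : nat) : R := (a + w * i%:R <= x)%R%:R.
(* The indicator of a half-open cell is a difference of two consecutive threshold functions, so the
   sum telescopes. *)
transitivity (- \sum_(0 <= i < N) (f i.+1 - f i)).
  rewrite big_mkord -sumrN; apply: eq_bigr => i _; rewrite opprB /f indicE /gcell.
  rewrite mem_setE in_itv /= ltNge.
  have [h|h] := leP (a + w * i.+1%:R) x; last by rewrite andbT subr0.
  by rewrite andbF (le_trans _ h) ?subrr// lerD2l ler_wpM2l// ler_nat leqnSn.
rewrite (telescope_sumr f)// opprB /f mulr0 addr0 ax.
by rewrite leNgt xN subr0.
Qed.

Lemma lebesgue_measure_gcell (a w : R) i : 0 <= w -> lebesgue_measure (gcell a w i) = w%:E.
Proof.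
move=> w0; rewrite /gcell lebesgue_measure_itv /= lte_fin -natr1.
case: ltP => [_|h]; first by rewrite -EFinD; congr EFin; ring.
by congr EFin; apply/eqP; rewrite eq_le w0 /=; move: h; lra.
Qed.

Lemma pair3_sum (I : finType) (f g h : I -> R) :
  \sum_(i : I * I * I) f i.1.1 * g i.1.2 * h i.2
    = (\sum_i f i) * (\sum_i g i) * (\sum_i h i).
Proof.
rewrite -(pair_bigA _ (fun ij k => f ij.1 * g ij.2 * h k)) /=.
under eq_bigr do rewrite -mulr_sumr.
rewrite -mulr_suml; congr (_ * _).
rewrite -(pair_bigA _ (fun i j => f i * g j)) /=.
by under eq_bigr do rewrite -mulr_sumr; rewrite mulr_suml.
Qed.

Definition gcell3 (a w : R) (i : nat * nat * nat) : set (pt R) :=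
  (gcell a w i.1.1 `*` gcell a w i.1.2) `*` gcell a w i.2.

Lemma measurable_gcell3 (a w : R) i : measurable (gcell3 a w i).
Proof. by apply: measurable_box; exact: measurable_itv. Qed.

Lemma leb3_gcell3 (a w : R) i : 0 <= w -> leb3 (gcell3 a w i) = (w ^+ 3)%:E.
Proof.
move=> w0; rewrite leb3X; try exact: measurable_itv.
by rewrite !lebesgue_measure_gcell// -!EFinM exprSr expr2.
Qed.

Lemma gcell_dist (a w : R) i (x y : R) : gcell a w i x -> gcell a w i y -> `|x - y| <= w.
Proof.
rewrite /gcell /= !in_itv /= -natr1 mulrDr mulr1 => /andP[? ?] /andP[? ?].
by rewrite ler_norml; apply/andP; split; lra.
Qed.

Lemma gcell3_dist (a w : R) i (x y : pt R) :
  gcell3 a w i x -> gcell3 a w i y -> `|x - y| <= w.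
Proof.
move=> [[x1 x2] x3] [[y1 y2] y3]; apply/pt_norm_le => -[[|[|[|//]]] k];
  by rewrite coordB; apply: gcell_dist; eassumption.
Qed.

Lemma gcell3_indic_sum (a w : R) N (x : pt R) : 0 <= w ->
  (forall k, a <= coord k x < a + w * N%:R) ->
  \sum_(i : 'I_N * 'I_N * 'I_N)
     \1_(gcell3 a w (val i.1.1, val i.1.2, val i.2)) x = 1 :> R.
Proof.
move=> w0 hx.
have := pair3_sum (fun i : 'I_N => \1_(gcell a w i) (c1 x))
  (fun i : 'I_N => \1_(gcell a w i) (c2 x)) (fun i : 'I_N => \1_(gcell a w i) (c3 x)).
rewrite !gcell_indic_sum ?mulr1//; [|exact: (hx ord_max)
  |exact: (hx (@Ordinal 3 1 isT))|exact: (hx ord0)].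
move=> <-; apply: eq_bigr => i _; rewrite !indicE -!natrM !mulnb; congr (_%:R).
congr nat_of_bool; apply/idP/idP.
  by rewrite inE => -[[h1 h2] h3]; rewrite !mem_set.
by move=> /andP[/andP[/set_mem h1 /set_mem h2] /set_mem h3]; rewrite inE.
Qed.

Lemma integral_step (I : finType) (s : I -> R) (Q : I -> set (pt R)) (D : set (pt R)) :
  measurable D -> (forall i, 0 <= s i) -> (forall i, measurable (Q i)) ->
  (\int[@leb3 R]_(x in D) (\sum_i s i * \1_(Q i) x)%:E
     = \sum_i (s i)%:E * leb3 (Q i `&` D))%E.
Proof.
move=> mD s0 mQ; under eq_integral do rewrite -sumEFin.
rewrite ge0_integral_sum//.
- apply: eq_bigr => i _; under eq_integral do rewrite EFinM.
  rewrite ge0_integralZl_EFin//; first (congr (_ * _)%E; by have := @integral_indic _ _ _ (@leb3 R) D mD (Q i) (mQ i)).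
  by apply/measurable_EFinP; exact: (measurable_indic (mQ i)).
- move=> i; apply/measurable_EFinP; apply: measurable_funM => //.
  exact: (measurable_indic (mQ i)).
- by move=> i x _; rewrite lee_fin mulr_ge0.
Qed.

End Grid.

Section LipschitzIntegral.
Variable R : realType.
Variables (K : set (pt R)) (F : pt R -> pt R) (L B : R) (phi psi : pt R -> R).
Hypothesis cK : compact K.
Hypothesis L0 : 0 < L.
Hypothesis B0 : 0 <= B.
Hypothesis FL : forall x y, K x -> K y -> `|F x - F y| <= L * `|x - y|.
Hypothesis mFK : measurable (F @` K).
Hypothesis phi0 : forall x, K x -> 0 <= phi x.
Hypothesis phiB : forall x, K x -> phi x <= B.
Hypothesis phi_cont : cont_on K phi.
Hypothesis mpsi : measurable_fun (F @` K) psi.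
Hypothesis psiF : forall x, K x -> psi (F x) = phi x.

(** On a cell that misses [K] the supremum of the empty set is 0, which matches the extension of
    [phi] by zero. *)
Let gsup (Q : set (pt R)) : R := sup [set phi x | x in K `&` Q].

Let gsup_ge Q x : K x -> Q x -> phi x <= gsup Q.
Proof.
move=> Kx Qx; apply: ub_le_sup; last by exists x.
by exists B => _ [y [Ky _] <-]; exact: phiB.
Qed.

Let gsup0 Q : K `&` Q = set0 -> gsup Q = 0.
Proof. by move=> h; rewrite /gsup h image_set0 sup0. Qed.

Let gsup_le Q c : 0 <= c -> (forall x, K x -> Q x -> phi x <= c) -> gsup Q <= c.
Proof.
move=> c0 h; have [/gsup0->//|/set0P[x [Kx Qx]]] := eqVneq (K `&` Q) set0.
apply: ge_sup; first by exists (phi x), x.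
by move=> _ [y [Ky Qy] <-]; exact: h.
Qed.

Let gsup_ge0 Q : 0 <= gsup Q.
Proof.
have [/gsup0->//|/set0P[x [Kx Qx]]] := eqVneq (K `&` Q) set0.
by rewrite (le_trans (phi0 Kx))// gsup_ge.
Qed.

Let cell S n (i : 'I_n.+1 * 'I_n.+1 * 'I_n.+1) : set (pt R) :=
  gcell3 (- S) (2 * S / n.+1%:R) (val i.1.1, val i.1.2, val i.2).

Let step S n x : R := \sum_i gsup (@cell S n i) * \1_(@cell S n i) x.

Let box S : set (pt R) := (`[-S, S[ `*` `[-S, S[) `*` `[-S, S[.

Let mbox S : measurable (box S).
Proof. by apply: measurable_box; exact: measurable_itv. Qed.

Let boxP S x : box S x <-> forall k, - S <= coord k x < S.
Proof.
rewrite /box; split=> [[[h1 h2] h3] [[|[|[|//]]] i]|h].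
- by move: h1; rewrite /= in_itv.
- by move: h2; rewrite /= in_itv.
- by move: h3; rewrite /= in_itv.
split; [split|]; rewrite /= in_itv /=.
- exact: (h ord0).
- exact: (h (@Ordinal 3 1 isT)).
- exact: (h ord_max).
Qed.

Let cell_box S n (i : 'I_n.+1 * 'I_n.+1 * 'I_n.+1) : 0 <= S -> cell S i `<=` box S.
Proof.
move=> S0; have n0 : 0 < n.+1%:R :> R by rewrite ltr0n.
have w0 : 0 <= 2 * S / n.+1%:R by rewrite divr_ge0 ?mulr_ge0// ltW.
have h (j : 'I_n.+1) : gcell (- S) (2 * S / n.+1%:R) j `<=` `[-S, S[%classic.
  move=> x; rewrite /gcell /= !in_itv /= => /andP[h1 h2]; apply/andP; split.
    by rewrite (le_trans _ h1)// lerDl mulr_ge0.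
  have : 2 * S / n.+1%:R * j.+1%:R <= 2 * S.
    rewrite mulrAC ler_pdivrMr// ler_wpM2l ?mulr_ge0// ler_nat; exact: ltn_ord.
  move=> le2S; rewrite (lt_le_trans h2)// -lerBrDl opprK (le_trans le2S)//; lra.
by move=> x [[h1 h2] h3]; split; [split|]; [exact: (h _ _ h1)|exact: (h _ _ h2)|exact: (h _ _ h3)].
Qed.

Let step_box S n x : 0 <= S -> box S x -> \sum_i \1_(@cell S n i) x = 1 :> R.
Proof.
move=> S0 /boxP hx; apply: gcell3_indic_sum; first by rewrite divr_ge0 ?mulr_ge0.
move=> k; have := hx k; rewrite divfK ?pnatr_eq0//.
by rewrite (_ : - S + 2 * S = S)//; ring.
Qed.

(** At a point of [K] this is the continuity of [phi] on [K]; off [K], which is closed, a small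
    enough cell around the point misses [K]. *)
Let step_cvg S x : 0 <= S -> box S x -> step S n x @[n --> \oo] --> (phi \_ K) x.
Proof.
move=> S0 bx; apply/cvgrPdist_le => e e0.
have [d d0 Hd] : exists2 d, 0 < d & forall Q : set (pt R), Q x ->
    (forall y, Q y -> `|x - y| < d) -> `|(phi \_ K) x - gsup Q| <= e.
  have [Kx|Kx] := pselect (K x).
    have [d d0 Hd] := phi_cont Kx e0; exists d => // Q Qx Qd.
    rewrite patchE mem_set//= distrC ler_norml lerBlDr lerBrDr.
    apply/andP; split.
      by rewrite (le_trans _ (gsup_ge Kx Qx))// gerDr oppr_le0 ltW.
    apply: gsup_le; first by rewrite addr_ge0 ?phi0// ltW.
    by move=> y Ky Qy; have := Hd y Ky (Qd y Qy); rewrite ler_norml => /andP[]; lra.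
  have : nbhs x (~` K).
    apply: open_nbhs_nbhs; split=> //; apply: closed_openC.
    by apply: compact_closed cK; exact: norm_hausdorff.
  case/nbhs_ballP => d /= d0 Hd; exists d => // Q Qx Qd.
  rewrite patchE memNset//= gsup0 ?subrr ?normr0 ?ltW//.
  apply/seteqP; split => // y [Ky Qy]; apply: (Hd y) => //.
  by rewrite prod_norm_ball; exact: Qd.
have S2 : 0 < 2 * S + 1 by rewrite ltr_wpDl// mulr_ge0.
have [N _ HN] := near_infty_natSinv_lt (PosNum (divr_gt0 d0 S2)).
exists N => // n /= Nn; have {HN} := HN n Nn => /= wd.
have {}wd : 2 * S / n.+1%:R < d.
  apply: le_lt_trans (_ : (2 * S + 1) * n.+1%:R^-1 < d).
    by rewrite ler_wpM2r// lerDl.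
  by rewrite mulrC -ltr_pdivlMr.
(* The cell indicators sum to 1 at [x], so both the limit and [e] can be distributed over the
   cells. *)
rewrite -[X in X - _]mulr1 -(step_box n S0 bx) mulr_sumr -sumrB.
rewrite (le_trans (ler_norm_sum _ _ _))//.
rewrite -[e]mulr1 -(step_box n S0 bx) mulr_sumr.
apply: ler_sum => i _; rewrite -mulrBl normrM [X in _ * X]ger0_norm//.
rewrite indicE; case: (boolP (x \in cell S i)) => [/set_mem xi|_]; last by rewrite !mulr0.
rewrite !mulr1; apply: Hd => // y yi.
by rewrite (le_lt_trans _ wd)//; apply: gcell3_dist xi yi.
Qed.

Let step_bound S n x : 0 <= S -> box S x -> `|step S n x| <= B.
Proof.
move=> S0 bx; rewrite ger0_norm; last first.
  by apply: sumr_ge0 => i _; rewrite mulr_ge0.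
rewrite -[B]mulr1 -(step_box n S0 bx) mulr_sumr; apply: ler_sum => i _.
rewrite ler_wpM2r//; apply: gsup_le => // y Ky _; exact: phiB.
Qed.

Let step_integral S n : 0 <= S ->
  (\int[@leb3 R]_(x in box S) (step S n x)%:E
    = (\sum_i gsup (@cell S n i) * (2 * S / n.+1%:R) ^+ 3)%:E)%E.
Proof.
move=> S0; rewrite integral_step//; last by move=> i; exact: measurable_gcell3.
rewrite -sumEFin; apply: eq_bigr => i _; rewrite setIidl; last exact: cell_box.
rewrite (_ : leb3 _ = ((2 * S / n.+1%:R) ^+ 3)%:E) ?EFinM//.
by apply: leb3_gcell3; rewrite divr_ge0 ?mulr_ge0.
Qed.

(** A cell of side [w] meeting [K] has diameter at most [w], so its part in [K] is mapped into a
    cube of half-side [L * w], whose volume is [(2 * L) ^+ 3] times that of the cell. The image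
    cubes may overlap; only an upper bound is needed. *)
Let psi_step S n : 0 <= S -> K `<=` box S ->
  (\int[@leb3 R]_(y in F @` K) (psi y)%:E
    <= ((2 * L) ^+ 3)%:E * \int[@leb3 R]_(x in box S) (step S n x)%:E)%E.
Proof.
move=> S0 KS; set w := 2 * S / n.+1%:R.
have w0 : 0 <= w by rewrite divr_ge0 ?mulr_ge0.
(* A cell that misses [K] receives an arbitrary centre, as no point of [K] has to be covered from
   it. *)
have /choice[y Hy] : forall i, exists y, K `&` @cell S n i !=set0 -> (K `&` cell S i) y.
  move=> i; have [[y Ky]|h] := pselect (K `&` cell S i !=set0); first by exists y.
  by exists (0, 0, 0).
pose Q i := cbox (F (y i)) (L * w).
have mQ i : measurable (Q i) by exact: measurable_cbox.
apply: (@le_trans _ _ (\int[@leb3 R]_(z in F @` K) (\sum_i gsup (@cell S n i) * \1_(Q i) z)%:E)%E).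
  apply: ge0_le_integral => //.
  - by move=> _ [x Kx <-]; rewrite lee_fin psiF// phi0.
  - exact/measurable_EFinP.
  - apply/measurable_EFinP; apply: measurable_sum => i; apply: measurable_funM => //.
    exact: (measurable_indic (mQ i)).
  move=> _ [x Kx <-]; rewrite lee_fin psiF//.
  have [i xi] : exists i, @cell S n i x.
    apply: contrapT => /forallNP h; have := step_box n S0 (KS _ Kx).
    rewrite big1 => [/eqP|i _]; first by rewrite eq_sym oner_eq0.
    by rewrite indicE memNset//; exact: h.
  rewrite (bigD1 i)//= (_ : \1_(Q i) (F x) = 1) ?mulr1; last first.
    rewrite indicE mem_set//; apply/cboxP.
    have [Ky yi] : (K `&` cell S i) (y i) by apply: Hy; exists x.
    rewrite (le_trans (FL Kx Ky))// ler_wpM2l ?(ltW L0)//.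
    exact: gcell3_dist xi yi.
  rewrite (le_trans (gsup_ge Kx xi))// lerDl sumr_ge0// => j _.
  by rewrite mulr_ge0.
rewrite integral_step// step_integral// -EFinM mulr_sumr -sumEFin.
apply: lee_sum => i _.
apply: (@le_trans _ _ ((gsup (cell S i))%:E * ((2 * (L * w)) ^+ 3)%:E)%E).
  apply: lee_wpmul2l; first by rewrite lee_fin.
  rewrite -(leb3_cbox (F (y i))) ?mulr_ge0 ?(ltW L0)//.
  apply: le_measure; last exact: subIsetl.
    by apply: mem_set; exact: (measurableI _ _ (mQ i) mFK).
  by apply: mem_set; exact: mQ.
by rewrite -EFinM lee_fin mulrA exprMn mulrCA.
Qed.

(** The estimate for step functions passes to the limit of vanishing mesh by dominated convergence
    on a bounded box containing [K], with the constant [B] as dominating function. *)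
Lemma lipschitz_integral_le :
  (\int[@leb3 R]_(y in F @` K) (psi y)%:E
    <= ((2 * L) ^+ 3)%:E * \int[@leb3 R]_(x in K) (phi x)%:E)%E.
Proof.
have [S S0 KS] : exists2 S, 0 <= S & K `<=` box S.
  have [M M0 HM] := compact_bound cK (@norm_continuous R (pt R)).
  exists (M + 1); first by rewrite addr_ge0// ltW.
  move=> x Kx; apply/boxP => k; have := HM x Kx; rewrite normr_id => xM.
  by have := le_trans (coord_le_norm k x) xM; rewrite ler_norml => /andP[? ?];
    apply/andP; split; lra.
have bfin : (leb3 (box S) < +oo)%E.
  rewrite /box leb3X; try exact: measurable_itv.
  by rewrite !lebesgue_measure_itv /=; case: ifP => _; rewrite -?EFinD -?EFinM ltry.
have mK : measurable K by exact: compact_measurable_pt.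
have cv : (\int[@leb3 R]_(x in box S) (step S n x)%:E @[n --> \oo]
     --> \int[@leb3 R]_(x in K) (phi x)%:E)%E.
  have -> : (\int[@leb3 R]_(x in K) (phi x)%:E
      = \int[@leb3 R]_(x in box S) ((phi \_ K) x)%:E)%E.
    rewrite -{1}(setIidr KS) integral_mkcondr; apply: eq_integral => x _.
    by rewrite (restrict_EFin phi K).
  apply: (@dominated_cvg _ _ _ (@leb3 R) _ (mbox S) _ _ (cst B%:E)).
  - move=> n; apply/measurable_EFinP; apply: measurable_sum => i.
    apply: measurable_funM => //.
    exact: (measurable_indic (measurable_gcell3 _ _ _)).
  - by move=> x bx; apply: cvg_EFin; [exact: nearW|exact: step_cvg].
  - by [].
  - apply/integrableP; split; first exact: measurable_cst.
    rewrite (_ : (fun x => `|cst B%:E x|%E) = cst `|B|%:E)//.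
    rewrite integral_cst//; last exact: mbox.
    by apply: lte_mul_pinfty.
  - by move=> n x bx; rewrite lee_fin step_bound.
apply: cvge_ge (cvgeZl _ cv) => //.
by apply: nearW => n; exact: psi_step.
Qed.

End LipschitzIntegral.

(** * Gram matrices *)

(** Inversion is continuous off 0, and the convention [0^-1 = 0] is dealt with on the singleton. *)
Lemma measurable_invr (R : realType) : measurable_fun setT (fun x : R => x^-1).
Proof.
have -> : [set: R] = ~` [set 0] `|` [set 0] by rewrite setUC setUv.
apply/measurable_funU; [exact: measurableC|exact: measurable_set1|split].
  apply: open_continuous_measurable_fun.
    by apply: closed_openC; exact: accessible_closed_set1 (hausdorff_accessible (@Rhausdorff R)) 0.
  by move=> x; rewrite inE /= => /eqP x0; apply: cvgV.
exact: measurable_fun_set1.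
Qed.

Section BoundedMeasurable.
Variable R : realType.
Variable D : set (pt R).
Hypothesis mD : measurable D.
Hypothesis finD : (leb3 D < +oo)%E.

(** On a set of finite measure this class lies within the integrable functions and, unlike them, is
    stable under products. *)
Definition bmf (f : pt R -> R) :=
  measurable_fun D f /\ exists B, forall x, D x -> `|f x| <= B.

Lemma bmfM f g : bmf f -> bmf g -> bmf (fun x => f x * g x).
Proof.
move=> [mf [B HB]] [mg [C HC]]; split; first exact: measurable_funM.
by exists (B * C) => x Dx; rewrite normrM ler_pM ?HB ?HC.
Qed.

Lemma bmf_cst c : bmf (fun=> c).
Proof. by split; [exact: measurable_cst|exists `|c|]. Qed.

Lemma bmf_sum (I : Type) (r : seq I) (f : I -> pt R -> R) :
  (forall i, bmf (f i)) -> bmf (fun x => \sum_(i <- r) f i x).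
Proof.
move=> bf; split; first by apply: measurable_sum => i; exact: (bf i).1.
have /choice[B HB] : forall i, exists B, forall x, D x -> `|f i x| <= B.
  by move=> i; exact: (bf i).2.
exists (\sum_(i <- r) B i) => x Dx; rewrite (le_trans (ler_norm_sum _ _ _))//.
by apply: ler_sum => i _; exact: HB.
Qed.

Lemma bmf_integrable f : bmf f -> (@leb3 R).-integrable D (EFin \o f).
Proof.
move=> [mf [B HB]]; apply/integrableP; split; first exact/measurable_EFinP.
apply: (@le_lt_trans _ _ (\int[@leb3 R]_(x in D) (cst `|B|%:E x))%E).
  apply: ge0_le_integral => //.
  - by apply/measurable_EFinP; apply: measurableT_comp.
  - by move=> x Dx; rewrite lee_fin (le_trans (HB x Dx))// ler_norm.
by rewrite integral_cst//; apply: lte_mul_pinfty.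
Qed.

Lemma Rintegral_sum (I : Type) (r : seq I) (f : I -> pt R -> R) :
  (forall i, bmf (f i)) ->
  Rintegral (@leb3 R) D (fun x => \sum_(i <- r) f i x)
    = \sum_(i <- r) Rintegral (@leb3 R) D (f i).
Proof.
move=> bf; elim: r => [|i r IH].
  by under eq_fun do rewrite big_nil; rewrite Rintegral_cst// mul0r big_nil.
under eq_fun do rewrite big_cons.
rewrite big_cons -IH; apply: RintegralD => //; apply: bmf_integrable => //.
exact: bmf_sum.
Qed.

Lemma gram_quadratic n (W : pt R -> R) (b : 'I_n -> pt R -> R) (w : 'rV[R]_n) :
  bmf W -> (forall i, bmf (b i)) ->
  (w *m (\matrix_(i, j) Rintegral (@leb3 R) D (fun x => W x * b i x * b j x))
     *m w^T) 0 0
  = Rintegral (@leb3 R) D (fun x => W x * (\sum_i w 0 i * b i x) ^+ 2).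
Proof.
move=> bW bb; have bWb i j : bmf (fun x => W x * b i x * b j x).
  by apply: bmfM (bb j); exact: bmfM.
have -> : (fun x => W x * (\sum_i w 0 i * b i x) ^+ 2)
    = (fun x => \sum_j \sum_i w 0 i * w 0 j * (W x * b i x * b j x)).
  apply/funext => x; rewrite expr2 mulr_sumr mulr_sumr; apply: eq_bigr => j _.
  by rewrite mulrA mulr_sumr mulr_suml; apply: eq_bigr => i _; ring.
have bwb i j : bmf (fun x => w 0 i * w 0 j * (W x * b i x * b j x)).
  by apply: bmfM => //; exact: bmf_cst.
rewrite Rintegral_sum => [|j]; last exact: bmf_sum.
rewrite mxE; apply: eq_bigr => j _; rewrite Rintegral_sum//.
rewrite !mxE mulr_suml; apply: eq_bigr => i _; rewrite !mxE RintegralZl//.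
  by ring.
exact: bmf_integrable.
Qed.

Lemma EFin_Rintegral f : bmf f ->
  (Rintegral (@leb3 R) D f)%:E = (\int[@leb3 R]_(x in D) (f x)%:E)%E.
Proof.
move=> bf; rewrite /Rintegral fineK//; apply: integrable_fin_num => //.
exact: bmf_integrable.
Qed.

End BoundedMeasurable.

Section CompactMeasure.
Variable R : realType.

Lemma compact_leb3_lty (K : set (pt R)) : compact K -> (leb3 K < +oo)%E.
Proof.
move=> cK; have [M M0 HM] := compact_bound cK (@norm_continuous R (pt R)).
apply: (@le_lt_trans _ _ (leb3 (cbox (0 : pt R) M))).
  apply: le_measure; [apply: mem_set; exact: compact_measurable_pt|
    apply: mem_set; exact: measurable_cbox|].
  by move=> x Kx; apply/cboxP; rewrite subr0 -[X in X <= _]normr_id; exact: HM.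
by rewrite leb3_cbox ?ltry// ltW.
Qed.

Lemma lipschitz_image_compact (K : set (pt R)) (F : pt R -> pt R) (L : R) :
  0 < L -> (forall x y, K x -> K y -> `|F x - F y| <= L * `|x - y|) ->
  compact K -> compact (F @` K).
Proof.
move=> L0 FL; apply: continuous_compact; apply/subspace_continuousP => x Kx.
apply/cvgrPdist_le => e e0; rewrite near_withinE; apply/nbhs_ballP.
exists (e / L) => /=; first by rewrite divr_gt0.
move=> y; rewrite prod_norm_ball /ball_ /= => xy Ky.
by rewrite (le_trans (FL _ _ Kx Ky))// mulrC -ler_pdivlMr// ltW.
Qed.

Lemma continuous_bmf (K : set (pt R)) f : compact K -> continuous f -> bmf K f.
Proof.
move=> cK cf; split; last by have [B _ HB] := compact_bound cK cf; exists B.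
by apply: cont_on_measurable; [exact: compact_measurable_pt|exact: continuous_cont_on].
Qed.

(** As [x] may lie on the boundary, the box of side [r] has [x] as a corner and extends in each
    coordinate towards the far side; [r <= 1/2] leaves room for it. It supplies the positive measure
    in [Rintegral_cube_gt0]. *)
Lemma cube_corner (x : pt R) r : cube x -> 0 < r -> r <= 2^-1 ->
  exists c, forall y, cbox c (r / 2) y -> cube y /\ `|x - y| <= r.
Proof.
move=> cx r0 r1; have /cube_coord x01 := cx.
pose m (t : R) := if t <= 2^-1 then t + r / 2 else t - r / 2.
have Hm (t u : R) : 0 <= t <= 1 -> `|u - m t| <= r / 2 -> 0 <= u <= 1 /\ `|t - u| <= r.
  rewrite /m => /andP[t0 t1]; case: (leP t 2^-1) => th; rewrite !ler_norml => /andP[h1 h2];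
    by split; apply/andP; split; lra.
exists (m (c1 x), m (c2 x), m (c3 x)) => y /cboxP /pt_norm_le H.
have H' k : 0 <= coord k y <= 1 /\ `|coord k x - coord k y| <= r.
  by apply: Hm => //; have := H k; rewrite coordB; case: k => [[|[|[|//]]] i].
split; first by apply/cube_coord => k; exact: (H' k).1.
by apply/pt_norm_le => k; rewrite coordB; exact: (H' k).2.
Qed.

Lemma Rintegral_cube_gt0 (f : pt R -> R) x0 : continuous f ->
  (forall x, cube x -> 0 <= f x) -> cube x0 -> f x0 != 0 ->
  0 < Rintegral (@leb3 R) (@cube R) f.
Proof.
move=> cf f0 cx0 fx0.
have mC := compact_measurable_pt (@cube_compact R).
have bf := continuous_bmf (@cube_compact R) cf.
have fp : 0 < f x0 by rewrite lt_def fx0 f0.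
have [d d0 Hd] := continuous_cont_on cf cx0 (divr_gt0 fp (ltr0Sn R 1)).
pose r := Num.min (d / 2) 2^-1.
have r0 : 0 < r by rewrite lt_min divr_gt0//= invr_gt0.
have rd : r < d by rewrite gt_min ltr_pdivrMr// ltr_pMr// ltr1n.
have r1 : r <= 2^-1 by rewrite ge_min lexx orbT.
have [c Hc] := cube_corner cx0 r0 r1.
have mB := measurable_cbox c (r / 2).
suff : ((f x0 / 2)%:E * leb3 (cbox c (r / 2)%R)
         <= \int[@leb3 R]_(x in (@cube R)) (f x)%:E)%E.
  rewrite leb3_cbox ?divr_ge0 ?(ltW r0)// -EFin_Rintegral//; last first.
    exact: compact_leb3_lty (@cube_compact R).
  rewrite -EFinM lee_fin; apply: lt_le_trans.
  by rewrite mulr_gt0 ?divr_gt0// exprn_gt0// mulr_gt0// divr_gt0.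
apply: (@le_trans _ _ (\int[@leb3 R]_(x in cbox c (r / 2)) (cst (f x0 / 2)%:E x))%E).
  by rewrite integral_cst.
apply: (@le_trans _ _ (\int[@leb3 R]_(x in cbox c (r / 2)) (f x)%:E)%E).
  apply: ge0_le_integral => //.
  - by move=> x _; rewrite lee_fin divr_ge0// ltW.
  - apply/measurable_EFinP; apply: cont_on_measurable => //.
    exact: continuous_cont_on.
  move=> x /Hc[cx xr]; rewrite lee_fin.
  by have := Hd x cx (le_lt_trans xr rd); rewrite ler_norml => /andP[]; lra.
apply: ge0_subset_integral => //.
- by apply/measurable_EFinP; exact: bf.1.
- by move=> x /Hc[].
Qed.

End CompactMeasure.

Section ChangeOfVariables.
Variable R : realType.
Variables (G : pt R -> pt R) (L : R).
Hypothesis L0 : 0 < L.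
Hypothesis GL : forall x y, cube x -> cube y -> `|G x - G y| <= L * `|x - y|.
Hypothesis GL' : forall x y, cube x -> cube y -> `|x - y| <= L * `|G x - G y|.

Lemma GinvP y : Omega G y -> cube (Ginv G y) /\ G (Ginv G y) = y.
Proof.
move=> [x cx Gx]; rewrite /Ginv; case: xgetP => [z -> [cz Gz]|/(_ x) []//].
by split.
Qed.

Lemma GinvK x : cube x -> Ginv G (G x) = x.
Proof.
move=> cx; have [cz Gz] : cube (Ginv G (G x)) /\ G (Ginv G (G x)) = G x.
  by apply: GinvP; exists x.
apply/eqP; rewrite -subr_eq0 -normr_le0.
by rewrite (le_trans (GL' cz cx))// Gz subrr normr0 mulr0.
Qed.

Lemma Omega_compact : compact (Omega G).
Proof. exact: lipschitz_image_compact L0 GL (@cube_compact R). Qed.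

Lemma Ginv_lipschitz y y' : Omega G y -> Omega G y' ->
  `|Ginv G y - Ginv G y'| <= L * `|y - y'|.
Proof.
move=> /GinvP[c1 e1] /GinvP[c2 e2].
by rewrite -[in X in _ <= X]e1 -[in X in _ <= X]e2 GL'.
Qed.

Lemma cont_on_Ginv (h : pt R -> R) : continuous h -> cont_on (Omega G) (h \o Ginv G).
Proof.
move=> ch; apply: (cont_on_comp (B := setT) L0) => //.
- by move=> *; exact: Ginv_lipschitz.
- exact: continuous_cont_on.
Qed.

Lemma bmf_Ginv (h : pt R -> R) : continuous h -> bmf (Omega G) (h \o Ginv G).
Proof.
move=> ch; split.
  by apply: cont_on_measurable; [exact: compact_measurable_pt Omega_compact|exact: cont_on_Ginv].
have [B _ HB] := compact_bound (@cube_compact R) ch.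
by exists B => y /GinvP[cy _]; exact: HB.
Qed.

Lemma Rintegral_Omega_le (h : pt R -> R) : continuous h -> (forall x, 0 <= h x) ->
  Rintegral (@leb3 R) (Omega G) (h \o Ginv G)
    <= (2 * L) ^+ 3 * Rintegral (@leb3 R) (@cube R) h.
Proof.
move=> ch h0; have cO := Omega_compact.
have mO := compact_measurable_pt cO; have mC := compact_measurable_pt (@cube_compact R).
have fO := compact_leb3_lty cO; have fC := compact_leb3_lty (@cube_compact R).
have [B B0 HB] := compact_bound (@cube_compact R) ch.
rewrite -lee_fin EFinM !EFin_Rintegral//; [|exact: continuous_bmf (@cube_compact R) ch
  |exact: bmf_Ginv].
apply: (lipschitz_integral_le (B := B)) => //.
- exact: cube_compact.
- exact: ltW.
- by move=> x cx; rewrite (le_trans (ler_norm _))// HB.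
- exact: continuous_cont_on.
- exact: (bmf_Ginv ch).1.
- by move=> x cx /=; rewrite GinvK.
Qed.

Lemma Rintegral_Omega_ge (h : pt R -> R) : continuous h -> (forall x, 0 <= h x) ->
  Rintegral (@leb3 R) (@cube R) h
    <= (2 * L) ^+ 3 * Rintegral (@leb3 R) (Omega G) (h \o Ginv G).
Proof.
move=> ch h0; have cO := Omega_compact.
have mO := compact_measurable_pt cO; have mC := compact_measurable_pt (@cube_compact R).
have fO := compact_leb3_lty cO; have fC := compact_leb3_lty (@cube_compact R).
have [B B0 HB] := compact_bound (@cube_compact R) ch.
rewrite -lee_fin EFinM !EFin_Rintegral//; [|exact: bmf_Ginv
  |exact: continuous_bmf (@cube_compact R) ch].
have cubeT : @cube R = Ginv G @` Omega G.
  apply/seteqP; split => [x cx|_ [y Oy <-]]; last by have [] := GinvP Oy.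
  by exists (G x); [exists x|exact: GinvK].
rewrite {1}cubeT.
apply: (lipschitz_integral_le (B := B)) => //.
- exact: ltW.
- by move=> *; exact: Ginv_lipschitz.
- by rewrite -cubeT.
- by move=> y _; exact: h0.
- by move=> y /GinvP[cy _]; exact: (le_trans (ler_norm _) (HB _ cy)).
- exact: cont_on_Ginv.
- by rewrite -cubeT; exact: (continuous_bmf (@cube_compact R) ch).1.
Qed.

End ChangeOfVariables.

(** * Weighted mass matrices and the spectral bounds *)

Section PressureMass.
Variable R : realType.

(** For RT the weight is the inverse square of the determinant. Clipping [|dJ|] from below at [L^-1]
    changes nothing on the cube and makes the weight continuous everywhere; the absolute value
    covers orientation-reversing [G]. *)
Lemma rho_weight (d : pdisc) (G : pt R -> pt R) (L : R) (dJ : pt R -> R) :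
  0 < L -> continuous dJ ->
  (forall x, cube x -> detJ G x = dJ x /\ L^-1 <= `|dJ x| <= L) ->
  exists (s : pt R -> R) (lo hi : R), [/\ 0 < lo, 0 < hi, continuous s,
    forall x, cube x -> lo <= s x <= hi &
    forall p a1 a2 a3 N i j y, cube (Ginv G y) ->
      rho d G p a1 a2 a3 N i y * rho d G p a1 a2 a3 N j y
      = s (Ginv G y) * (tp_basis p a1 a2 a3 N i (Ginv G y)
                        * tp_basis p a1 a2 a3 N j (Ginv G y))].
Proof.
move=> L0 cdJ HJ; have iL0 : 0 < L^-1 by rewrite invr_gt0.
case: d.
  exists (fun=> 1), 1, 1; split => //; [by move=> x; exact: cvg_cst|
    by move=> *; rewrite lexx|by move=> *; rewrite mul1r].
exists (fun x => (Num.max L^-1 `|dJ x|)^-1 ^+ 2), (L^-1 ^+ 2), (L ^+ 2).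
split; rewrite ?exprn_gt0//.
- move=> x; apply: (@continuous_comp _ _ _ (fun x => (Num.max L^-1 `|dJ x|)^-1)
      (fun t : R => t ^+ 2)); last exact: exprn_continuous.
  apply: cvgV; first by rewrite gt_eqF// lt_max iL0.
  apply: (@continuous_max R (pt R) (fun=> L^-1) (fun y => `|dJ y|) x); first exact: cvg_cst.
  by apply: continuous_comp; [exact: cdJ|exact: norm_continuous].
- move=> x cx; have [_ /andP[h1 h2]] := HJ x cx; rewrite max_r//.
  have J0 : 0 < `|dJ x| by exact: lt_le_trans h1.
  rewrite !ler_pXn2r ?nnegrE ?invr_ge0 ?(ltW L0)//.
  by rewrite lef_pV2 ?posrE// h2 invf_ple ?posrE.
move=> p a1 a2 a3 N i j y cx; have [e /andP[h1 h2]] := HJ _ cx.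
rewrite /rho e max_r// -normfV real_normK ?num_real//; ring.
Qed.

Lemma PQmat_quadratic p a1 a2 a3 N (w : 'rV[R]_(tp_dim p a1 a2 a3 N)) :
  (a1 < p)%N -> (a2 < p)%N -> (a3 < p)%N -> (0 < N)%N ->
  (w *m PQmat R p a1 a2 a3 N *m w^T) 0 0
  = Rintegral (@leb3 R) (@cube R) (fun x => (\sum_i w 0 i * tpd p a1 a2 a3 N 3 i x) ^+ 2).
Proof.
move=> ap1 ap2 ap3 N0; have mC := compact_measurable_pt (@cube_compact R).
have fC := compact_leb3_lty (@cube_compact R).
transitivity ((w *m (\matrix_(i, j) Rintegral (@leb3 R) (@cube R)
   (fun x => (fun=> 1) x * tpd p a1 a2 a3 N 3 i x * tpd p a1 a2 a3 N 3 j x)) *m w^T) 0 0).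
  congr ((_ *m _ *m _) 0 0); apply/matrixP => i j; rewrite !mxE.
  by apply: eq_Rintegral => x; rewrite inE => cx; rewrite !tp_basisE// mul1r.
rewrite gram_quadratic//; first by apply: eq_Rintegral => x _; rewrite mul1r.
- exact: bmf_cst.
- by move=> i; apply: continuous_bmf; [exact: cube_compact|exact: tpd_continuous].
Qed.

Lemma PQmat_quadratic_gt0 p a1 a2 a3 N (w : 'rV[R]_(tp_dim p a1 a2 a3 N)) :
  (a1 < p)%N -> (a2 < p)%N -> (a3 < p)%N -> (0 < N)%N -> w != 0 ->
  0 < (w *m PQmat R p a1 a2 a3 N *m w^T) 0 0.
Proof.
move=> ap1 ap2 ap3 N0 w0; rewrite PQmat_quadratic//.
have [x0 cx0 fx0] : exists2 x, cube x & \sum_i w 0 i * tpd p a1 a2 a3 N 3 i x != 0.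
  apply: contrapT => h; move/eqP: w0; apply; apply/rowP => i; rewrite mxE.
  apply: (tp_free ap1 ap2 ap3 N0 (c := fun i => w 0 i)) => x cx.
  apply/eqP; apply: contrapT => /negP h'; apply: h; exists x => //.
  by move: h'; under eq_bigr do rewrite tp_basisE//.
apply: (Rintegral_cube_gt0 (x0 := x0)) => //.
- move=> x; apply: (@continuous_comp _ _ _ (fun x => \sum_i w 0 i * tpd p a1 a2 a3 N 3 i x)
      (fun t : R => t ^+ 2)); last exact: exprn_continuous.
  apply: continuous_sumr => i {}x; apply: cvgM; first exact: cvg_cst.
  exact: tpd_continuous.
- by move=> x _; exact: sqr_ge0.
- by rewrite expf_neq0.
Qed.

Lemma PQmat_unit p a1 a2 a3 N :
  (a1 < p)%N -> (a2 < p)%N -> (a3 < p)%N -> (0 < N)%N ->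
  PQmat R p a1 a2 a3 N \in unitmx.
Proof.
move=> ap1 ap2 ap3 N0; rewrite -row_free_unit; apply: inj_row_free => w wP.
apply: contrapT => /eqP w0; have := PQmat_quadratic_gt0 ap1 ap2 ap3 N0 w0.
by rewrite wP mul0mx mxE ltxx.
Qed.

(* Replaces the a.e. bounds on [nu] by everywhere bounds on a clipped copy,
   which changes no integral. *)
Lemma Qmat_weight (d : pdisc) (G : pt R -> pt R) (nu : pt R -> R) (L : R)
    (dJ : pt R -> R) : 0 < L ->
  (forall x y, cube x -> cube y -> `|G x - G y| <= L * `|x - y|) ->
  (forall x y, cube x -> cube y -> `|x - y| <= L * `|G x - G y|) ->
  continuous dJ ->
  (forall x, cube x -> detJ G x = dJ x /\ L^-1 <= `|dJ x| <= L) ->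
  measurable_fun (Omega G) nu ->
  (exists c M : R, 0 < c /\
     {ae @leb3 R, forall y, Omega G y -> c <= nu y <= M}) ->
  exists (W : pt R -> R) (lo hi : R), [/\ 0 < lo, 0 < hi, bmf (Omega G) W,
    forall y, Omega G y -> lo <= W y <= hi &
    forall p a1 a2 a3 N,
     (a1 < p)%N -> (a2 < p)%N -> (a3 < p)%N -> (0 < N)%N ->
     Qmat d G nu p a1 a2 a3 N = \matrix_(i, j) Rintegral (@leb3 R) (Omega G)
       (fun y => W y * (tpd p a1 a2 a3 N 3 i \o Ginv G) y
                     * (tpd p a1 a2 a3 N 3 j \o Ginv G) y)].
Proof.
move=> L0 GL GL' cdJ HJ mnu [c [M' [c0 aenu]]].
have cO := Omega_compact L0 GL; have mO := compact_measurable_pt cO.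
have [s [lo [hi [lo0 hi0 cs sb rhoE]]]] := rho_weight d L0 cdJ HJ.
(* The maximum guarantees [0 < c <= M], which the almost-everywhere bounds do not give when
   [Omega G] is null. *)
pose M := Num.max c M'; have M0 : 0 < M by rewrite lt_max c0.
have cM : c <= M by rewrite le_max lexx.
pose clip (t : R) := (Num.max c (Num.min t M))^-1.
have clip_cont : continuous clip.
  move=> t; apply: cvgV; first by rewrite gt_eqF// lt_max c0.
  apply: (@continuous_max R R (fun=> c) (fun u => Num.min u M) t); first exact: cvg_cst.
  by apply: (@continuous_min R R id (fun=> M) t); [exact: cvg_id|exact: cvg_cst].
have clipb t : M^-1 <= clip t <= c^-1.
  have m0 : 0 < Num.max c (Num.min t M) by rewrite lt_max c0.
  rewrite /clip !lef_pV2 ?posrE//; apply/andP; split.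
    by rewrite ge_max cM ge_min lexx orbT.
  by rewrite le_max lexx.
pose W y := clip (nu y) * s (Ginv G y).
have mclip : measurable_fun (Omega G) (clip \o nu).
  by apply: measurableT_comp => //; exact: continuous_measurable_fun.
have bclip : bmf (Omega G) (clip \o nu).
  split => //; exists c^-1 => y _ /=; have /andP[h1 h2] := clipb (nu y).
  by rewrite ger0_norm// (le_trans _ h1)// invr_ge0 ltW.
have bW : bmf (Omega G) W by apply: bmfM bclip (bmf_Ginv L0 GL GL' cs).
exists W, (M^-1 * lo), (c^-1 * hi); split=> //.
- by rewrite mulr_gt0 ?invr_gt0.
- by rewrite mulr_gt0 ?invr_gt0.
- move=> y /GinvP[cy _]; have /andP[h1 h2] := clipb (nu y); have /andP[h3 h4] := sb _ cy.
  have i0 : 0 <= M^-1 by rewrite invr_ge0 ltW.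
  rewrite /W !ler_pM// ?(ltW lo0)//.
    by rewrite (le_trans i0).
  by rewrite (le_trans (ltW lo0)).
move=> p a1 a2 a3 N ap1 ap2 ap3 N0; apply/matrixP => i j; rewrite !mxE.
have bt k : bmf (Omega G) (tpd p a1 a2 a3 N 3 k \o Ginv G).
  by apply: (bmf_Ginv L0 GL GL'); exact: tpd_continuous.
have rE y : Omega G y -> (nu y)^-1 * rho d G p a1 a2 a3 N i y * rho d G p a1 a2 a3 N j y
    = (nu y)^-1 * s (Ginv G y) * (tpd p a1 a2 a3 N 3 i \o Ginv G) y
                     * (tpd p a1 a2 a3 N 3 j \o Ginv G) y.
  by move=> /GinvP[cy _]; rewrite -mulrA rhoE// !tp_basisE//= !mulrA.
transitivity (Rintegral (@leb3 R) (Omega G) (fun y => (nu y)^-1 * s (Ginv G y)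
     * (tpd p a1 a2 a3 N 3 i \o Ginv G) y * (tpd p a1 a2 a3 N 3 j \o Ginv G) y)).
  by apply: eq_Rintegral => y; rewrite inE => Oy; exact: rE.
congr fine; apply: ae_eq_integral => //.
- apply/measurable_EFinP; apply: measurable_funM; last exact: (bt j).1.
  apply: measurable_funM; last exact: (bt i).1.
  apply: measurable_funM; last exact: (bmf_Ginv L0 GL GL' cs).1.
  by apply: (measurableT_comp (f := fun x : R => x^-1)) => //; exact: measurable_invr.
- apply/measurable_EFinP; apply: measurable_funM; last exact: (bt j).1.
  apply: measurable_funM; last exact: (bt i).1.
  exact: bW.1.
move: aenu; apply: negligibleS => y /=; apply: contra_not => h Oy; have /andP[h1 h2] := h Oy.
by rewrite /W /clip min_l ?max_r// /M le_max h2 orbT.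
Qed.

End PressureMass.

(** As [Q] is symmetric and [P] is symmetric positive definite, the eigenvalues of [P^-1 Q] are
    real, so bounding every real eigenvalue bounds both extreme ones. The lower bound on [nu] keeps
    [1 / nu] bounded, as [Theta] requires; the upper bound gives [theta]. *)
Theorem theorem2 (R : realType) (d : pdisc) (G : pt R -> pt R) (nu : pt R -> R) :
  spline_map G ->
  {in cube (R:=R) &, injective G} ->
  (forall x, cube x -> forall k l : 'I_3, partial_exists G k l x) ->
  (forall x, cube x -> detJ G x != 0) ->
  measurable_fun (Omega G) nu ->
  (exists c M : R, 0 < c /\
     {ae @leb3 R, forall y, Omega G y -> c <= nu y <= M}) ->
  exists theta Theta : R, 0 < theta /\ 0 < Theta /\
    forall (p a1 a2 a3 N : nat),
      (a1 < p)%N -> (a2 < p)%N -> (a3 < p)%N -> (0 < N)%N ->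
      forall lambda : R,
        eigenvalue (invmx (PQmat R p a1 a2 a3 N) *m Qmat d G nu p a1 a2 a3 N) lambda ->
        theta <= lambda <= Theta.
Proof.
move=> Gs Ginj Gder Gdet mnu nub.
have [L [dJ [L0 GL GL' cdJ HJ]]] := spline_map_bilipschitz Gs Ginj Gder Gdet.
have [W [lo [hi [lo0 hi0 bW Wb QE]]]] := Qmat_weight d L0 GL GL' cdJ HJ mnu nub.
have cO := Omega_compact L0 GL; have mO := compact_measurable_pt cO.
have fO := compact_leb3_lty cO.
pose C := (2 * L) ^+ 3; have C0 : 0 < C by rewrite exprn_gt0// mulr_gt0.
(* [lo] and [hi] bound the weight and [C] is the distortion of integrals under [G] and its inverse;
   all three are fixed before [p] and [N]. *)
exists (lo / C), (hi * C); rewrite divr_gt0// mulr_gt0//; do 2!split => //.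
move=> p a1 a2 a3 N ap1 ap2 ap3 N0 lambda /eigenvalueP[v vE v0].
have uP := PQmat_unit R ap1 ap2 ap3 N0.
pose w := v *m invmx (PQmat R p a1 a2 a3 N).
have vw : v = w *m PQmat R p a1 a2 a3 N by rewrite /w mulmxKV.
have w0 : w != 0 by apply: contraNneq v0 => w0; rewrite vw w0 mul0mx.
have qP0 := PQmat_quadratic_gt0 ap1 ap2 ap3 N0 w0.
have qE : (w *m Qmat d G nu p a1 a2 a3 N *m w^T) 0 0
    = lambda * (w *m PQmat R p a1 a2 a3 N *m w^T) 0 0.
  by rewrite -vw /w -[v *m _ *m _]mulmxA vE -scalemxAl mxE.
pose f x := \sum_i w 0 i * tpd p a1 a2 a3 N 3 i x.
have cf2 : continuous (fun x => f x ^+ 2).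
  move=> x; apply: (@continuous_comp _ _ _ f (fun t : R => t ^+ 2)); last exact: exprn_continuous.
  apply: continuous_sumr => i {}x; apply: cvgM; first exact: cvg_cst.
  exact: tpd_continuous.
have bf2 := bmf_Ginv L0 GL GL' cf2.
have bt k : bmf (Omega G) (tpd p a1 a2 a3 N 3 k \o Ginv G).
  by apply: (bmf_Ginv L0 GL GL'); exact: tpd_continuous.
move: qE qP0; rewrite QE// gram_quadratic// PQmat_quadratic//.
rewrite -/(f _); set qQ := Rintegral _ _ _; set qP := Rintegral _ _ _ => qE qP0.
pose I := Rintegral (@leb3 R) (Omega G) ((fun x => f x ^+ 2) \o Ginv G).
have I1 : I <= C * qP by apply: (Rintegral_Omega_le L0 GL GL' cf2) => x; exact: sqr_ge0.
have I2 : qP <= C * I by apply: (Rintegral_Omega_ge L0 GL GL' cf2) => x; exact: sqr_ge0.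
have scal c : Rintegral (@leb3 R) (Omega G) (fun y => c * ((fun x => f x ^+ 2) \o Ginv G) y) = c * I.
  by apply: RintegralZl => //; exact: bmf_integrable.
have bcf c : bmf (Omega G) (fun y => c * ((fun x => f x ^+ 2) \o Ginv G) y).
  by apply: bmfM bf2 => //; exact: bmf_cst.
have Q1 : lo * I <= qQ.
  rewrite -scal; apply: le_Rintegral => //.
  - exact: bmf_integrable.
  - by apply: bmf_integrable => //; exact: bmfM.
  - by move=> y Oy; rewrite ler_wpM2r ?sqr_ge0//; have /andP[] := Wb y Oy.
have Q2 : qQ <= hi * I.
  rewrite -scal; apply: le_Rintegral => //.
  - by apply: bmf_integrable => //; exact: bmfM.
  - exact: bmf_integrable.
  - by move=> y Oy; rewrite ler_wpM2r ?sqr_ge0//; have /andP[] := Wb y Oy.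
(* The chains are [lo * qP / C <= lo * I <= qQ = lambda * qP] and [lambda * qP = qQ <= hi * I <= hi
   * C * qP], with [qP > 0] cancelled. *)
apply/andP; split.
  rewrite -(ler_pM2r qP0) -qE (le_trans _ Q1)// mulrAC ler_pdivrMr//.
  by rewrite -mulrA (mulrC I) ler_pM2l.
by rewrite -(ler_pM2r qP0) -qE (le_trans Q2)// -mulrA ler_pM2l.
Qed.
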